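(* Let $(X_t)$ be a strictly stationary sequence of real random variables such that, for some $\alpha\in(0,2)$ and some normalizing sequence $(a_n)$, $nP(|X_0|>a_nx)\to x^{-\alpha}$ as $n\to\infty$ for every $x>0$. Assume that $(|X_t|)$ has extremal index equal to one. Let $p=p_n=\lfloor n^\kappa\rfloor$ for some $\kappa\ge1$. Suppose that, for any $x>0$, $$\lim_{n\to\infty}\frac{P\big(\sum_{t=1}^n|X_t|>a_{np}x\big)}{nP(|X_0|>a_{np}x)}=1\qquad\text{and}\qquad\lim_{n\to\infty}\frac{P\big(\sum_{t=1}^nX_t^2>a_{np}^2x\big)}{nP(X_0^2>a_{np}^2x)}=1.$$ Let $\mathbf X=(X_{it})_{1\le i\le p,\,1\le t\le n}$ be the $p\times n$ random matrix whose rows $(X_{it})_{1\le t\le n}$ are independent copies of $(X_t)_{1\le t\le n}$, and let $\lambda_{\max}$ be the largest eigenvalue of $\mathbf X\mathbf X^{\mathsf T}$. Then, as $n\to\infty$, $$\frac{\lambda_{\max}}{\max_{1\le i\le p,\,1\le t\le n}X_{it}^2}\ \longrightarrow\ 1\quad\text{in probability}.$$ In particular, for every $x>0$, $$\lim_{n\to\infty}P\big(\lambda_{\max}\le a_{np}^2x\big)=\exp\big(-x^{-\alpha/2}\big).$$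
   Context: $a_{np}$ is the term of the sequence $(a_m)$ with index $m=n\,p_n$. A strictly stationary sequence $(Y_t)$ has extremal index $\theta$ if for every $\tau>0$ there is a sequence $(u_n)$ with $nP(Y_0>u_n)\to\tau$ and $P(\max_{1\le t\le n}Y_t\le u_n)\to e^{-\theta\tau}$ as $n\to\infty$. *)

(* Defs.v *)
From HB Require Import structures.
From mathcomp Require Import all_boot all_order all_algebra.
From mathcomp Require Import all_classical all_reals all_analysis.

Set Implicit Arguments.
Unset Strict Implicit.
Unset Printing Implicit Defensive.

Import Order.TTheory GRing.Theory Num.Theory.
Import numFieldNormedType.Exports.

Local Open Scope classical_set_scope.
Local Open Scope ring_scope.

(* Equality of the laws of f and g, which may live on different probability
   spaces; both are meant to be measurable. *)
Definition same_law (R : realType) (d1 d2 d : measure_display)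
    (T1 : measurableType d1) (T2 : measurableType d2) (S : measurableType d)
    (P1 : probability T1 R) (P2 : probability T2 R)
    (f : T1 -> S) (g : T2 -> S) : Prop :=
  forall A : set S, measurable A -> P1 (f @^-1` A) = P2 (g @^-1` A).

Definition strictly_stationary (R : realType) (d : measure_display)
    (T : measurableType d) (P : probability T R) (X : nat -> T -> R) : Prop :=
  forall (h m : nat) (s : 'I_m -> nat),
    same_law P P (fun w => [tuple X (s i) w | i < m])
                 (fun w => [tuple X (s i + h)%N w | i < m]).

(* For n >= 1 the seed [Y 1 w] of the iterated maximum is one of its terms, so
   that it is max_{1 <= t <= n} Y_t, whatever the signs of the Y_t. *)
Definition has_extremal_index (R : realType) (d : measure_display)
    (T : measurableType d) (P : probability T R) (Y : nat -> T -> R)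
    (theta : R) : Prop :=
  forall tau : R, 0 < tau ->
    exists u : nat -> R,
      (fun n : nat => n%:R * fine (P [set w | u n < Y 0%N w]))
        @ \oo --> tau /\
      (fun n : nat => fine (P [set w |
          \big[Num.max/Y 1%N w]_(1 <= t < n.+1) Y t w <= u n]))
        @ \oo --> expR (- (theta * tau)).

Definition mutually_independent (R : realType) (d d' : measure_display)
    (T : measurableType d) (S : measurableType d') (P : probability T R)
    (I : finType) (f : I -> T -> S) : Prop :=
  forall (J : {set I}) (A : I -> set S), (forall i, measurable (A i)) ->
    fine (P [set w | forall i, i \in J -> A i (f i w)]) =
    \prod_(i in J) fine (P (f i @^-1` A i)).

(* Convergence in probability to the constant c, where the n-th variable may
   live on its own probability space. *)
Definition cvg_in_probability (R : realType) (d : nat -> measure_display)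
    (T : forall n, measurableType (d n)) (P : forall n, probability (T n) R)
    (Z : forall n, T n -> R) (c : R) : Prop :=
  forall eps : R, 0 < eps ->
    (fun n : nat => fine (P n [set w | eps < `|Z n w - c|])) @ \oo --> (0 : R).

(* The spectrum is finite, and it is nonempty when A is a real symmetric matrix
   of size n >= 1; the supremum is then the largest eigenvalue. *)
Definition max_eigenvalue (R : realType) (n : nat) (A : 'M[R]_n) : R :=
  sup [set a : R | eigenvalue A a].

Definition nrows (R : realType) (kappa : R) (n : nat) : nat :=
  Num.truncn (n%:R `^ kappa : R).

(* The squares being nonnegative, the seed 0 does not affect the maximum. *)
Definition max_sqr_entry (R : realType) (m n : nat) (A : 'M[R]_(m, n)) : R :=
  \big[Num.max/0]_(i < m) \big[Num.max/0]_(t < n) (A i t ^+ 2).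

(* Main.v *)
Require Import Defs.
From HB Require Import structures.
From mathcomp Require Import all_boot all_order all_algebra.
From mathcomp Require Import all_classical all_reals all_analysis.
From mathcomp Require Import measurable_realfun.
From mathcomp Require Import ring lra.

Set Implicit Arguments.
Unset Strict Implicit.
Unset Printing Implicit Defensive.

Import Order.TTheory GRing.Theory Num.Theory.
Import numFieldNormedType.Exports.

Local Open Scope classical_set_scope.
Local Open Scope ring_scope.

(** A matrix whose entries exceeding some level sit in distinct rows and
    distinct columns, all other entries being zero, has its largest absolute
    entry as operator norm.  The proof shows that [X] is of this kind, up to
    negligible errors.  Write [B = a_{np} ^+ 2],
    [beta = alpha / 2 < 1] and call an entry large if its square exceeds
    [s * B] for a small constant [s].

    - Small entries.  Their squares sum, in mean, to at most
      [n p * E min(X_0^2, s B)].  As [X_0^2] has a regularly varying tail of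
      index [beta < 1], this is at most [C * s^(1 - beta) * B]
      ([truncated_mean_scaled]), so their Frobenius norm is small compared with
      the scale of the maximum when [s] is small.
    - Columns.  Entries of one column are independent, so two large ones share
      a column with probability at most
      [n p^2 P(X_0^2 > s B)^2 = O(1 / n)].
    - Rows.  Let [S1] and [S2] be the sum of the absolute values and the sum of
      the squares of a row.  By hypothesis [S1^2] and [S2 <= S1^2] have
      asymptotically the same tail at scale [B], so they cannot differ by a
      positive fraction of [B] except with probability [o(1 / p)]
      ([gap_negligible]).  But two large entries of a row make
      [S1^2 - S2 >= s B].

    Splitting [X] into large and small entries gives
    [lambda_max <= (1 + dl) * max X_it^2 + (1 + 1/dl) * (small part)]
    ([max_eigenvalue_le_max_sqr_entry]), while [max X_it^2 <= lambda_max]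
    always, by the Rayleigh quotients at basis vectors; hence the ratio tends
    to [1].

    The same gap estimate shows that the largest square of a row has
    the tail of [S2] ([gap_cvg_tail]); as the rows are independent, the largest
    squared entry of [X], and therefore [lambda_max], has the limit law
    [exp (- x^-beta)].

    The law of [lambda_max] makes sense only once [lambda_max] is known to be
    measurable; this follows from its description as the supremum of the
    Rayleigh quotients over the countable set of integer vectors. *)

(** * Rayleigh quotients and the largest eigenvalue *)

Section SquaredNorm.
Variable R : realType.

Definition sqnorm n (u : 'rV[R]_n) : R := \sum_j u 0 j ^+ 2.

Lemma sqnormE n (u : 'rV[R]_n) : sqnorm u = (u *m u^T) 0 0.
Proof. by rewrite mxE; apply: eq_bigr => j _; rewrite mxE expr2. Qed.

Lemma sqnorm_ge0 n (u : 'rV[R]_n) : 0 <= sqnorm u.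
Proof. by apply: sumr_ge0 => j _; exact: sqr_ge0. Qed.

Lemma sqnorm_gt0 n (u : 'rV[R]_n) : u != 0 -> 0 < sqnorm u.
Proof.
move=> u0; rewrite lt_neqAle sqnorm_ge0 andbT eq_sym; apply: contraNneq u0.
move=> /eqP; rewrite psumr_eq0 => [/allP h|j _]; last exact: sqr_ge0.
apply/eqP/rowP => j; rewrite mxE; apply/eqP.
by have := h j (mem_index_enum _); rewrite sqrf_eq0.
Qed.

Lemma sqnorm_mul_trmx m n (v : 'rV[R]_m) (A : 'M[R]_(m, n)) :
  (v *m (A *m A^T) *m v^T) 0 0 = sqnorm (v *m A).
Proof. by rewrite sqnormE trmx_mul !mulmxA. Qed.

Lemma sum_sqr_mul_le (I : finType) (x y : I -> R) :
  (\sum_i x i * y i) ^+ 2 <= (\sum_i x i ^+ 2) * (\sum_i y i ^+ 2).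
Proof.
have : 0 <= \sum_i \sum_j (x i * y j - x j * y i) ^+ 2.
  by apply: sumr_ge0 => i _; apply: sumr_ge0 => j _; exact: sqr_ge0.
suff -> : \sum_i \sum_j (x i * y j - x j * y i) ^+ 2 =
    2 * ((\sum_i x i ^+ 2) * (\sum_i y i ^+ 2) - (\sum_i x i * y i) ^+ 2).
  by rewrite pmulr_rge0// subr_ge0.
have dbl (f g : I -> R) : (\sum_i f i) * (\sum_i g i) =
    \sum_i \sum_j f i * g j.
  by rewrite mulr_suml; apply: eq_bigr => i _; rewrite mulr_sumr.
rewrite expr2 mulrBr [2 * _]mulr_natl mulr2n {2}[_ * (\sum_i y i ^+ 2)]mulrC !dbl.
rewrite mulr_sumr -big_split -sumrB; apply: eq_bigr => i _ /=.
rewrite mulr_sumr -big_split -sumrB; apply: eq_bigr => j _ /=.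
by ring.
Qed.

Lemma sqnorm_mulmx_le m n (v : 'rV[R]_m) (A : 'M[R]_(m, n)) :
  sqnorm (v *m A) <= (\sum_j \sum_i A i j ^+ 2) * sqnorm v.
Proof.
rewrite mulr_suml; apply: ler_sum => j _.
by rewrite mxE mulrC; exact: sum_sqr_mul_le.
Qed.

Lemma eigenvalue_mul_trmx_le m n (A : 'M[R]_(m, n)) (a c : R) :
  (forall v, sqnorm (v *m A) <= c * sqnorm v) ->
  eigenvalue (A *m A^T) a -> a <= c.
Proof.
move=> h /eigenvalueP[v vA v0].
have := h v; rewrite -sqnorm_mul_trmx vA -scalemxAl mxE -sqnormE.
by rewrite ler_pM2r// sqnorm_gt0.
Qed.

(** The supremum of the Rayleigh quotients is attained, without compactness.
    If [l] is that supremum and [B = l%:M - A *m A^T] were invertible,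
    nonnegativity of the form [B] at [v - K^-1 *: (v *m invmx B)],
    for [K] large, would bound all the Rayleigh quotients by [l - K^-1]. *)
Lemma rayleigh_sup_eigenvalue m n (A : 'M[R]_(m, n)) : (0 < m)%N ->
  exists2 a : R, eigenvalue (A *m A^T) a &
    forall v, sqnorm (v *m A) <= a * sqnorm v.
Proof.
move=> m0.
set S := [set sqnorm (v *m A) / sqnorm v | v in [set v : 'rV[R]_m | v != 0]].
have ubS (c : R) : (forall v, sqnorm (v *m A) <= c * sqnorm v) <-> ubound S c.
  split=> [h _ [v /= v0 <-]|h v]; first by rewrite ler_pdivrMr ?sqnorm_gt0.
  have [->|v0] := eqVneq v 0.
    by rewrite mul0mx /sqnorm !big1 ?mulr0// => j _; rewrite mxE expr0n.
  by rewrite -ler_pdivrMr ?sqnorm_gt0//; apply: h; exists v.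
have hS : has_sup S.
  split; last by exists (\sum_j \sum_i A i j ^+ 2); apply/ubS => v; exact: sqnorm_mulmx_le.
  pose v : 'rV[R]_m := const_mx 1.
  exists (sqnorm (v *m A) / sqnorm v), v => //=.
  by apply/eqP => /rowP/(_ (Ordinal m0)); rewrite !mxE => /eqP; rewrite oner_eq0.
have supS : forall v, sqnorm (v *m A) <= sup S * sqnorm v.
  by apply/ubS; apply: sup_upper_bound.
exists (sup S) => //; have [//|neig] := boolP (eigenvalue _ _); exfalso.
set l := sup S in neig supS.
pose B := l%:M - A *m A^T.
have Bu : B \in unitmx.
  rewrite -row_free_unit -kermx_eq0 /B -opprB.
  move: neig; rewrite /eigenvalue /eigenspace negbK => /eqP k0.
  apply/eqP/row_matrixP => i; rewrite row0.
  apply/eqP; rewrite -submx0 -k0 sub_kermx.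
  have /eqP := mulmx_ker (- (A *m A^T - l%:M)).
  by rewrite mulmxN oppr_eq0 -row_mul => /eqP ->; rewrite row0.
have Bsym : B^T = B by rewrite /B linearB/= tr_scalar_mx trmx_mul trmxK.
have formB (v : 'rV[R]_m) : (v *m B *m v^T) 0 0 = l * sqnorm v - sqnorm (v *m A).
  rewrite /B mulmxBr mulmxBl mxE [X in _ + X]mxE sqnorm_mul_trmx.
  by rewrite mul_mx_scalar -scalemxAl mxE -sqnormE.
have formB_ge0 (v : 'rV[R]_m) : 0 <= (v *m B *m v^T) 0 0 by rewrite formB subr_ge0.
pose K := 1 + \sum_j \sum_i invmx B i j ^+ 2.
have K0 : 0 < K.
  rewrite ltr_pwDl//; apply: sumr_ge0 => j _; apply: sumr_ge0 => i _.
  exact: sqr_ge0.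
have key (v : 'rV[R]_m) : sqnorm (v *m A) <= (l - K^-1) * sqnorm v.
  pose w := v *m invmx B.
  have wB : w *m B = v by rewrite /w -mulmxA mulVmx// mulmx1.
  have vBw : v *m B *m w^T = v *m v^T.
    have -> : v^T = B *m w^T by rewrite -[in LHS]wB trmx_mul Bsym.
    by rewrite mulmxA.
  have vw : (v *m w^T) 0 0 <= K * sqnorm v.
    have wle : sqnorm w <= (K - 1) * sqnorm v.
      by rewrite /K addrC addKr; exact: sqnorm_mulmx_le.
    have h2 : 2 * (v *m w^T) 0 0 <= sqnorm v + sqnorm w.
      rewrite mxE /sqnorm mulr_sumr -big_split/=; apply: ler_sum => j _.
      rewrite mxE; have := sqr_ge0 (v 0 j - w 0 j); lra.
    have := sqnorm_ge0 v; have := sqnorm_ge0 w; nra.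
  have := formB_ge0 (v - K^-1 *: w).
  have -> : (v - K^-1 *: w)^T = v^T - K^-1 *: w^T by rewrite linearB/= linearZ.
  rewrite mulmxBl mulmxBr !mulmxBl -!scalemxAr -!scalemxAl wB vBw !mxE => h.
  have {h} : 0 <= (v *m B *m v^T) 0 0 - 2 * K^-1 * sqnorm v
                  + K^-1 ^+ 2 * (v *m w^T) 0 0.
    apply: le_trans h _; rewrite sqnormE !mxE; lra.
  rewrite formB => h.
  have : K^-1 ^+ 2 * (v *m w^T) 0 0 <= K^-1 * sqnorm v.
    rewrite expr2 -mulrA ler_pM2l ?invr_gt0//.
    by rewrite ler_pdivrMl.
  lra.
have : l <= l - K^-1 by apply: sup_le_ub hS.1 _; apply/ubS.
by rewrite leNgt gtrBl invr_gt0 K0.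
Qed.

Lemma max_eigenvalue_leP m n (A : 'M[R]_(m, n)) (c : R) : (0 < m)%N ->
  max_eigenvalue (A *m A^T) <= c <->
  forall v, sqnorm (v *m A) <= c * sqnorm v.
Proof.
move=> /(rayleigh_sup_eigenvalue A)[a eiga ha].
have -> : max_eigenvalue (A *m A^T) = a.
  apply/eqP; rewrite eq_le; apply/andP; split.
    by apply: sup_le_ub => [|b]; [exists a | exact: eigenvalue_mul_trmx_le].
  apply: ub_le_sup => //; exists a => b; exact: eigenvalue_mul_trmx_le.
split=> [ac v|]; last by move/eigenvalue_mul_trmx_le; exact.
by apply: le_trans (ha v) _; rewrite ler_wpM2r// sqnorm_ge0.
Qed.

End SquaredNorm.

(** * Bounding the largest eigenvalue by the entries *)

Section EntrywiseBounds.
Variable R : realType.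
Implicit Types (m n : nat) (c e dl : R).

Lemma max_sqr_entry_ge0 m n (A : 'M[R]_(m, n)) : 0 <= max_sqr_entry A.
Proof. exact: bigmax_ge_id. Qed.

Lemma max_sqr_entry_leP m n (A : 'M[R]_(m, n)) c : 0 <= c ->
  max_sqr_entry A <= c <-> forall i t, A i t ^+ 2 <= c.
Proof.
move=> c0; split=> [Ac i t|Ac].
  apply: le_trans Ac; apply: le_trans (le_bigmax _ _ i).
  exact: (le_bigmax 0 (fun t => A i t ^+ 2)).
by apply/bigmax_leP; split=> // i _; apply/bigmax_leP; split=> // t _.
Qed.

Lemma le_max_sqr_entry m n (A : 'M[R]_(m, n)) i t :
  A i t ^+ 2 <= max_sqr_entry A.
Proof. exact: (max_sqr_entry_leP A (max_sqr_entry_ge0 A)).1. Qed.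

Lemma max_sqr_entry_le_max_eigenvalue m n (A : 'M[R]_(m, n)) : (0 < m)%N ->
  max_sqr_entry A <= max_eigenvalue (A *m A^T).
Proof.
move=> m0; set l := max_eigenvalue _.
have /(max_eigenvalue_leP _ _ m0) hl : l <= l by [].
have h i t : A i t ^+ 2 <= l.
  have := hl (delta_mx 0 i); rewrite -rowE.
  have -> : sqnorm (delta_mx 0 i : 'rV[R]_m) = 1.
    rewrite /sqnorm (bigD1 i)//= big1 => [|j ji]; rewrite !mxE ?eqxx.
      by rewrite expr1n addr0.
    by rewrite (negbTE ji) andbF expr0n.
  rewrite mulr1; apply: le_trans.
  rewrite /sqnorm (bigD1 t)//= mxE lerDl.
  by apply: sumr_ge0 => j _; exact: sqr_ge0.
suff l0 : 0 <= l by exact/(max_sqr_entry_leP _ l0).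
case: m m0 A @l hl {h} => // m _ A l hl.
have := hl (const_mx 1); have := sqnorm_ge0 (const_mx 1 *m A).
move=> /le_trans h1 /h1; rewrite pmulr_lge0// sqnorm_gt0//.
by apply/eqP => /rowP/(_ ord0); rewrite !mxE => /eqP; rewrite oner_eq0.
Qed.

Lemma sqrrD_le (x y dl : R) : 0 < dl ->
  (x + y) ^+ 2 <= (1 + dl) * x ^+ 2 + (1 + dl^-1) * y ^+ 2.
Proof.
move=> dl0; rewrite -subr_ge0.
suff -> : (1 + dl) * x ^+ 2 + (1 + dl^-1) * y ^+ 2 - (x + y) ^+ 2 =
   dl * (x - dl^-1 * y) ^+ 2 by rewrite mulr_ge0 ?sqr_ge0// ltW.
by field; rewrite gt_eqF.
Qed.

Lemma zero_or_single_support (I : finType) (f : I -> R) :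
  (forall i j, f i != 0 -> f j != 0 -> i = j) ->
  (forall i, f i = 0) \/ exists i, f i != 0 /\ forall j, j != i -> f j = 0.
Proof.
move=> h; have [/existsP[i fi]|/existsPn f0] := boolP [exists i, f i != 0].
  right; exists i; split=> // j ji; apply: contraNeq ji => fj.
  by rewrite (h j i).
by left=> i; apply/eqP; have := f0 i; rewrite negbK.
Qed.

(** Large entries, those with square above [c], sit in distinct rows and
    columns, so they form a matrix whose operator norm is its largest entry; the
    other entries enter through their Frobenius norm.  The weights [1 + dl] and
    [1 + dl^-1] come from [sqrrD_le]. *)
Lemma max_eigenvalue_le_max_sqr_entry m n (A : 'M[R]_(m, n)) c e dl :
  (0 < m)%N -> 0 <= c -> 0 < dl ->
  (forall i s t, c < A i s ^+ 2 -> c < A i t ^+ 2 -> s = t) ->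
  (forall t i j, c < A i t ^+ 2 -> c < A j t ^+ 2 -> i = j) ->
  \sum_i \sum_t Num.min (A i t ^+ 2) c <= e ->
  max_eigenvalue (A *m A^T) <= (1 + dl) * max_sqr_entry A + (1 + dl^-1) * e.
Proof.
move=> m0 c0 dl0 hrow hcol hsum; apply/max_eigenvalue_leP => // v.
pose B i t := if c < A i t ^+ 2 then A i t else 0.
pose E i t := if c < A i t ^+ 2 then 0 else A i t.
have AE i t : A i t = B i t + E i t.
  by rewrite /B /E; case: ifP; rewrite ?addr0 ?add0r.
have B0 i t : B i t != 0 -> c < A i t ^+ 2 by rewrite /B; case: ifP; rewrite ?eqxx.
have hB : \sum_t (\sum_i v 0 i * B i t) ^+ 2 <= max_sqr_entry A * sqnorm v.
  apply: (@le_trans _ _ (\sum_t \sum_i (v 0 i * B i t) ^+ 2)).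
    apply: ler_sum => t _; set f := fun i => v 0 i * B i t.
    have [i j||] := @zero_or_single_support _ f.
    - rewrite !mulf_eq0 !negb_or => /andP[_ /B0 hi] /andP[_ /B0 hj].
      exact: hcol hi hj.
    - move=> f0; rewrite big1 => [|i _]; last exact: f0.
      by rewrite expr0n; apply: sumr_ge0 => i _; exact: sqr_ge0.
    - move=> [i [_ fi]]; rewrite (bigD1 i)//= big1 ?addr0// (bigD1 i)//= lerDl.
      by apply: sumr_ge0 => j _; exact: sqr_ge0.
  rewrite exchange_big/= mulr_sumr; apply: ler_sum => i _.
  under eq_bigr do rewrite exprMn.
  rewrite -mulr_sumr mulrC ler_wpM2r ?sqr_ge0//.
  have [s t /B0 hs /B0 ht||] := @zero_or_single_support _ (B i).
  - exact: hrow hs ht.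
  - move=> f0; rewrite big1 => [|t _]; first exact: max_sqr_entry_ge0.
    by rewrite f0 expr0n.
  - move=> [t [ft fs]]; rewrite (bigD1 t)//= big1 => [|s st]; last by rewrite fs// expr0n.
    by rewrite addr0 /B B0//; exact: le_max_sqr_entry.
have hE : \sum_t (\sum_i v 0 i * E i t) ^+ 2 <= e * sqnorm v.
  apply: (@le_trans _ _ (\sum_t (\sum_i v 0 i ^+ 2) * (\sum_i E i t ^+ 2))).
    by apply: ler_sum => t _; exact: sum_sqr_mul_le.
  rewrite -mulr_sumr mulrC ler_wpM2r ?sqnorm_ge0//.
  apply: le_trans hsum; rewrite exchange_big/=.
  apply: ler_sum => i _; apply: ler_sum => t _; rewrite /E le_min.
  by case: ltP => h; rewrite ?expr0n ?sqr_ge0 ?lexx.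
apply: (@le_trans _ _ (\sum_t ((1 + dl) * (\sum_i v 0 i * B i t) ^+ 2
                   + (1 + dl^-1) * (\sum_i v 0 i * E i t) ^+ 2))).
  apply: ler_sum => t _; rewrite mxE.
  under eq_bigr do rewrite AE mulrDr.
  by rewrite big_split; exact: sqrrD_le.
rewrite big_split/= -!mulr_sumr [leRHS]mulrDl -!mulrA lerD// ler_wpM2l//.
  by rewrite addr_ge0// ltW.
by rewrite addr_ge0// ltW// invr_gt0.
Qed.

End EntrywiseBounds.

(** * Measurability of the largest eigenvalue *)

Section MaxEigenvalueMeasurable.
Variable R : realType.

Lemma cvg_floor_scaled (x : R) :
  (fun k : nat => k.+1%:R^-1 * (Num.floor (k.+1%:R * x))%:~R) @ \oo --> x.
Proof.
apply: (@squeeze_cvgr _ _ _ _ (fun k => x - k.+1%:R^-1) (fun=> x)).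
- near=> k; have k0 : 0 < k.+1%:R :> R by rewrite ltr0n.
  have /andP[h1 h2] := floor_itv (k.+1%:R * x).
  rewrite ler_pdivrMl// h1 andbT ler_pdivlMl//.
  move: h2; rewrite intrD mulrBr divff ?gt_eqF// => h2.
  by rewrite lerBlDr ltW.
- rewrite -[X in _ --> X]subr0; apply: cvgB; first exact: cvg_cst.
  exact: cvg_harmonic.
- exact: cvg_cst.
Unshelve. all: by end_near. Qed.

Lemma sqnormZ n (a : R) (u : 'rV[R]_n) : sqnorm (a *: u) = a ^+ 2 * sqnorm u.
Proof. by rewrite /sqnorm mulr_sumr; apply: eq_bigr => j _; rewrite mxE exprMn. Qed.

Lemma cvg_sum_fin (I : Type) (r : seq I) (f : I -> nat -> R) (l : I -> R) :
  (forall i, f i @ \oo --> l i) ->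
  (fun k => \sum_(i <- r) f i k) @ \oo --> \sum_(i <- r) l i.
Proof.
move=> h; elim: r => [|i r ih].
  under eq_fun do rewrite big_nil; rewrite big_nil; exact: cvg_cst.
under eq_fun do rewrite big_cons; rewrite big_cons; exact: cvgD.
Qed.

(** By homogeneity and density, integer vectors suffice to bound the Rayleigh
    quotients; this makes the largest eigenvalue a countable supremum. *)
Lemma rayleigh_le_int m n (A : 'M[R]_(m, n)) (c : R) :
  (forall z : 'rV[int]_m, sqnorm (map_mx intr z *m A) <=
     c * sqnorm (map_mx intr z : 'rV[R]_m)) ->
  forall v : 'rV[R]_m, sqnorm (v *m A) <= c * sqnorm v.
Proof.
move=> h v.
pose z k : 'rV[int]_m := \row_i Num.floor (k.+1%:R * v 0 i).
pose u k : 'rV[R]_m := k.+1%:R^-1 *: map_mx intr (z k).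
have hu k : sqnorm (u k *m A) <= c * sqnorm (u k).
  by rewrite -scalemxAl !sqnormZ mulrCA ler_wpM2l ?sqr_ge0.
have cu i : (fun k => u k 0 i) @ \oo --> v 0 i.
  under eq_fun do rewrite !mxE; exact: cvg_floor_scaled.
have cl : (fun k => sqnorm (u k *m A)) @ \oo --> sqnorm (v *m A).
  apply: cvg_sum_fin => j; under eq_fun do rewrite expr2; rewrite expr2.
  suff hj : (fun k => (u k *m A) 0 j) @ \oo --> (v *m A) 0 j by exact: cvgM.
  under eq_fun do rewrite mxE; rewrite mxE.
  by apply: cvg_sum_fin => i; apply: cvgM => //; exact: cvg_cst.
have cr : (fun k => c * sqnorm (u k)) @ \oo --> c * sqnorm v.
  apply: cvgM; first exact: cvg_cst.
  apply: cvg_sum_fin => j; under eq_fun do rewrite expr2; rewrite expr2.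
  exact: cvgM.
rewrite -subr_ge0; apply: (cvgr_to_ge (cvgB cr cl)).
by near=> k; rewrite subr_ge0.
Unshelve. all: by end_near. Qed.

Lemma measurable_max_eigenvalue d (T : measurableType d) m n
    (M : T -> 'M[R]_(m, n)) : (0 < m)%N ->
  (forall i t, measurable_fun setT (fun w => M w i t)) ->
  measurable_fun setT (fun w => max_eigenvalue (M w *m (M w)^T)).
Proof.
move=> m0 mM; apply: (measurability _ (RGenOInfty.measurableE R)).
move=> /= _ [_ [c ->] <-]; rewrite setTI.
rewrite (_ : _ @^-1` _ = \bigcup_(z in [set: 'rV[int]_m]) [set w |
  c * sqnorm (map_mx intr z : 'rV[R]_m) < sqnorm (map_mx intr z *m M w)]).
  apply: countable_bigcupT_measurable => [|z]; first exact: countableP.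
  rewrite -[X in measurable X]setTI.
  apply: (@measurable_fun_ltr _ _ _ _ (fun=> _) (fun w => sqnorm (map_mx intr z *m M w))) => //.
  apply: measurable_sum => j; apply: measurable_funX.
  under eq_fun do rewrite mxE.
  by apply: measurable_sum => i; apply: measurable_funM.
apply/seteqP; split=> w /=.
  rewrite in_itv/= andbT => hc; apply: contrapT => nz; move: hc; rewrite ltNge => /negP; apply.
  apply/max_eigenvalue_leP => //; apply: rayleigh_le_int => z.
  by rewrite leNgt; apply/negP => hz; apply: nz; exists z.
move=> [z _ /=]; rewrite ltNge => /negP hz; rewrite in_itv/= andbT ltNge.
by apply/negP => /(max_eigenvalue_leP _ _ m0)/(_ (map_mx intr z)).
Qed.

Lemma measurable_max_sqr_entry d (T : measurableType d) m n
    (M : T -> 'M[R]_(m, n)) :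
  (forall i t, measurable_fun setT (fun w => M w i t)) ->
  measurable_fun setT (fun w => max_sqr_entry (M w)).
Proof.
move=> mM.
have mbig (I : Type) (r : seq I) (f : I -> T -> R) :
    (forall i, measurable_fun setT (f i)) ->
    measurable_fun setT (fun w => \big[Num.max/0]_(i <- r) f i w).
  move=> mf; elim: r => [|i r ih].
    by under eq_fun do rewrite big_nil; exact: measurable_cst.
  by under eq_fun do rewrite big_cons; exact: measurable_maxr.
by apply: (mbig) => i; apply: (mbig) => t; exact: measurable_funX.
Qed.

End MaxEigenvalueMeasurable.

(** * Regularly varying tails *)

Section PowerFacts.
Variable R : realType.
Implicit Types (x y r e : R).

Lemma powR_root r x : r != 0 -> 0 < x -> (x `^ r^-1) `^ r = x.
Proof. by move=> r0 x0; rewrite -powRrM mulVf// powRr1// ltW. Qed.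

Lemma le_powRN r x y : 0 < r -> 0 < x -> x <= y -> y `^ (- r) <= x `^ (- r).
Proof.
move=> r0 x0 xy; have y0 : 0 < y by exact: lt_le_trans xy.
rewrite !powRN lef_pV2 ?posrE ?powR_gt0//.
by apply: ge0_ler_powR => //; rewrite ?nnegrE ltW.
Qed.

Lemma cvg_powR r x : 0 < x -> y `^ r @[y --> x] --> x `^ r.
Proof.
move=> x0.
have near_pos : \forall y \near x, 0 < y by exact: (lt_nbhsr x0).
have E y : 0 < y -> expR (r * ln y) = y `^ r by move=> y0; rewrite /powR gt_eqF.
have c1 : r * ln y @[y --> x] --> r * ln x.
  by apply: cvgM; [exact: cvg_cst | exact: continuous_ln].
have c2 : expR (r * ln y) @[y --> x] --> expR (r * ln x).
  by apply: continuous_cvg c1; exact: continuous_expR.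
rewrite -(E x x0); apply: cvg_trans c2.
by apply: near_eq_cvg; near=> y; rewrite E//; near: y.
Unshelve. all: by end_near. Qed.

Lemma cvg_natV : (fun n : nat => n%:R^-1 : R) @ \oo --> 0.
Proof.
apply/cvgrPdist_lt => e e0; near=> n.
have en : e^-1 < n%:R by near: n; exact: nbhs_infty_gtr.
have n0 : (0 : R) < n%:R by apply: lt_trans en; rewrite invr_gt0.
by rewrite sub0r normrN gtr0_norm ?invr_gt0// invf_plt ?posrE.
Unshelve. all: by end_near. Qed.

(** Squeezed by [exp(- y / (1 - y)) <= 1 - y <= exp(- y)]. *)
Lemma cvg_expn_onem (p : nat -> nat) (y : nat -> R) (c : R) :
  (forall n, 0 <= y n) -> y @ \oo --> 0 ->
  (fun n => (p n)%:R * y n) @ \oo --> c ->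
  (fun n => (1 - y n) ^+ p n) @ \oo --> expR (- c).
Proof.
move=> y0 cy cpy.
have E t : 0 <= t < 1 -> expR (- (t / (1 - t))) <= 1 - t <= expR (- t).
  move=> /andP[t0 t1]; rewrite expR_ge1Dx andbT expRN.
  have t1' : 0 < 1 - t by rewrite subr_gt0.
  rewrite invf_ple ?posrE ?expR_gt0//; apply: le_trans (expR_ge1Dx _).
  rewrite le_eqVlt; apply/orP; left; apply/eqP; field; lra.
have cexp (f : nat -> R) : f @ \oo --> c -> (fun n => expR (- f n)) @ \oo --> expR (- c).
  move=> cf; apply: (@continuous_cvg _ _ _ _ _ (fun n => - f n) expR).
    exact: continuous_expR.
  exact: cvgN.
apply: (@squeeze_cvgr _ _ _ _ (fun n => expR (- ((p n)%:R * y n / (1 - y n))))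
    (fun n => expR (- ((p n)%:R * y n)))).
- near=> n.
  have /andP[h1 h2] : expR (- (y n / (1 - y n))) <= 1 - y n <= expR (- y n).
    by apply: E; rewrite y0/=; near: n; exact: cvgr_lt cy _ ltr01.
  rewrite -mulrA -[- (_ * (y n / _))]mulrN -[- (_ * y n)]mulrN !expRM_natl.
  have h0 : 0 <= 1 - y n := le_trans (expR_ge0 _) h1.
  by apply/andP; split; apply: lerXn2r; rewrite ?nnegrE ?expR_ge0.
- apply: cexp; rewrite -[X in _ --> X]divr1; apply: cvgM => //.
  apply: cvgV; first exact: oner_neq0.
  by rewrite -[X in _ --> X]subr0; apply: cvgB => //; exact: cvg_cst.
- exact: cexp.
Unshelve. all: by end_near. Qed.

End PowerFacts.

Section RegularVariation.
Variables (R : realType) (G : R -> R) (b : nat -> R) (beta : R).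
Hypothesis beta0 : 0 < beta.
Hypothesis G_nonincreasing : forall x y, x <= y -> G y <= G x.
Hypothesis b_gt0 : \forall n \near \oo, 0 < b n.
Hypothesis cvgG : forall z, 0 < z ->
  (fun n : nat => n%:R * G (b n * z)) @ \oo --> z `^ (- beta).

Let cvgG1 : (fun n : nat => n%:R * G (b n)) @ \oo --> (1 : R).
Proof.
rewrite [X in _ --> X](_ : 1 = 1 `^ (- beta)); last by rewrite powR1.
by under eq_fun do rewrite -[b _]mulr1; exact: cvgG ltr01.
Qed.

Lemma rv_tail_small e : 0 < e -> exists z, G z < e.
Proof.
move=> e0; have [n [n0 hn ne]] : exists n : nat, [/\ (0 < n)%N, n%:R * G (b n) < 2 & 2 / e < n%:R].
  near \oo => n; exists n; split; near: n; first exact: nbhs_infty_gt.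
    by apply: cvgr_lt cvgG1 _ _; lra.
  exact: nbhs_infty_gtr.
exists (b n); move: ne; rewrite ltr_pdivrMr// => ne.
by rewrite -(ltr_pM2l (_ : 0 < n%:R)) ?ltr0n//; exact: lt_trans ne.
Unshelve. all: by end_near. Qed.

(** If the tail vanished from some level on, the positive limits along [b] would
    force [b] to tend to [0], and the tail would then vanish at all positive
    levels, including [b n] itself. *)
Lemma rv_tail_gt0 z : 0 < G z.
Proof.
rewrite ltNge; apply/negP => Gz.
have small e : 0 < e -> \forall n \near \oo, b n < e.
  move=> e0; have k0 : 0 < (`|z| + 1) / e.
    by rewrite divr_gt0// ltr_pwDr.
  near=> n; have n0 : (0 < n)%N by near: n; exact: nbhs_infty_gt.
  have : 0 < n%:R * G (b n * ((`|z| + 1) / e)).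
    by near: n; apply: cvgr_gt (cvgG k0) _ _; exact: powR_gt0.
  rewrite pmulr_rgt0 ?ltr0n// => h; rewrite ltNge; apply/negP => hb.
  move: h; rewrite ltNge => /negP; apply; apply: le_trans Gz.
  apply: G_nonincreasing; rewrite mulrA ler_pdivlMr// mulrC.
  apply: (@le_trans _ _ (e * (`|z| + 1))); last by rewrite ler_pM2r// ltr_pwDr.
  by rewrite ler_pM2l// ler_wpDr// ler_norm.
have Gle0 e : 0 < e -> G e <= 0.
  move=> e0; rewrite leNgt; apply/negP => Ge.
  near \oo => n.
  have n0 : (0 : R) < n%:R by rewrite ltr0n; near: n; exact: nbhs_infty_gt.
  have h1 : n%:R * G (b n) < 2 by near: n; apply: cvgr_lt cvgG1 _ _; lra.
  have h2 : 2 / G e < n%:R by near: n; exact: nbhs_infty_gtr.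
  have h3 : G e <= G (b n).
    by apply: G_nonincreasing; apply: ltW; near: n; exact: small.
  move: h2; rewrite ltr_pdivrMr// => h2.
  have : n%:R * G e <= n%:R * G (b n) by rewrite ler_pM2l.
  by move=> h; have := lt_trans (lt_le_trans h2 h) h1; rewrite ltxx.
near \oo => n.
have bn0 : 0 < b n by near: n.
have : 0 < n%:R * G (b n) by near: n; apply: cvgr_gt cvgG1 _ _; exact: ltr01.
by rewrite ltNge mulr_ge0_le0// Gle0.
Unshelve. all: by end_near. Qed.

Lemma rv_scale_infty K : \forall n \near \oo, K < b n.
Proof.
near=> n.
have n0 : (0 : R) < n%:R by rewrite ltr0n; near: n; exact: nbhs_infty_gt.
have h1 : n%:R * G (b n) < 2 by near: n; apply: cvgr_lt cvgG1 _ _; lra.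
have h2 : 2 / G K < n%:R by near: n; exact: nbhs_infty_gtr.
rewrite ltNge; apply/negP => /G_nonincreasing bK.
move: h2; rewrite ltr_pdivrMr ?rv_tail_gt0// => h2.
have : n%:R * G K <= n%:R * G (b n) by rewrite ler_pM2l.
by move=> h; have := lt_trans (lt_le_trans h2 h) h1; rewrite ltxx.
Unshelve. all: by end_near. Qed.

(** Regular variation of the tail, as a one-sided doubling inequality.  With [m]
    the integer part of [(G (2 * z))^-1], monotonicity places [2 * z] above
    [b m * theta] for any [theta < 1] and large [m]; hence [G z] is at most
    [G (b m * (theta / 2))], about [(theta / 2) `^ (- beta) / m]. *)
Lemma rv_doubling q : 2 `^ beta < q ->
  exists2 z0, 0 < z0 & forall z, z0 <= z -> G z <= q * G (2 * z).
Proof.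
move=> hq.
have q0 : 0 < q by apply: lt_trans hq; exact: powR_gt0.
(* the limit of [m * G (b m * (theta / 2))] tends to [2 `^ beta] as [theta]
   increases to [1] *)
have [theta [th0 th1 hth]] : exists theta : R,
    [/\ 0 < theta, theta < 1 & (theta / 2) `^ (- beta) < q].
  have h2 : (2^-1 : R) `^ (- beta) = 2 `^ beta.
    by rewrite -(powR_inv1 (ler0n _ 2)) -powRrM mulrNN mul1r.
  have c2 := @cvg_powR R (- beta) 2^-1 ltac:(lra).
  have : \forall y \near (2^-1 : R), y `^ (- beta) < q.
    by apply: cvgr_lt c2 _ _; rewrite h2.
  move=> /nbhs_ballP[e /= e0 he].
  (* the maximum with [4^-1] keeps [theta] positive *)
  pose y := Num.max (4^-1) (2^-1 - e / 2).
  have y1 : 4^-1 <= y /\ 2^-1 - e / 2 <= y by rewrite !le_max !lexx orbT.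
  have y2 : y < 2^-1 by rewrite gt_max; apply/andP; split; lra.
  exists (2 * y); split; [lra|lra|].
  rewrite (_ : 2 * y / 2 = y); last by field.
  by apply: he; rewrite /ball/= ltr_norml; apply/andP; split; lra.
have th2 : 0 < theta / 2 by lra.
have [N _ hN] : \forall m \near \oo, [/\ (0 < m)%N,
    1 < m%:R * G (b m * theta) & m.+1%:R * G (b m * (theta / 2)) < q].
  near=> m; split; near: m; first exact: nbhs_infty_gt.
    apply: cvgr_gt (cvgG th0) _ _.
    rewrite powRN invf_gt1 ?powR_gt0//.
    have := @gt0_ltr_powR R beta beta0 theta 1.
    by rewrite powR1 !nnegrE; apply => //; exact: ltW.
  have : (fun m : nat => (1 + m%:R^-1) * (m%:R * G (b m * (theta / 2)))) @ \oo --> (theta / 2) `^ (- beta).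
    rewrite -[X in _ --> X]mul1r; apply: cvgM; last exact: cvgG.
    rewrite -[X in _ --> X]addr0; apply: cvgD; first exact: cvg_cst.
    exact: cvg_natV.
  move=> /(cvgr_lt _) /(_ _ hth) h; near=> m.
  have m0 : (0 < m)%N by near: m; exact: nbhs_infty_gt.
  have -> : m.+1%:R = (1 + m%:R^-1) * m%:R :> R.
    by rewrite mulrDl mul1r mulVf ?pnatr_eq0 -?lt0n// -natr1.
  by rewrite -mulrA; near: m.
have [z1 hz1] : exists z, G z < N.+1%:R^-1 by apply: rv_tail_small; rewrite invr_gt0.
exists (Num.max 1 z1) => [|z]; first by rewrite lt_max ltr01.
rewrite ge_max => /andP[z_ge1 zz1].
pose g := G (2 * z).
have g0 : 0 < g := rv_tail_gt0 _.
have gN : g < N.+1%:R^-1.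
  by apply: le_lt_trans hz1; apply: G_nonincreasing; lra.
pose m := Num.truncn g^-1.
have /andP[m1 m2] := truncn_itv (ltW (ltac:(by rewrite invr_gt0) : 0 < g^-1)).
have Nm : (N <= m)%N.
  rewrite /m; apply: ltnW; rewrite truncn_ge_nat; last by rewrite invr_ge0 ltW.
  by rewrite -[leLHS]invrK lef_pV2 ?posrE ?invr_gt0 ?ltr0n// ltW.
have [m0 hm1 hm2] := hN m Nm.
have m0' : (0 : R) < m%:R by rewrite ltr0n.
have lt2z : b m * theta < 2 * z.
  rewrite ltNge; apply/negP => /G_nonincreasing; apply/negP; rewrite -ltNge.
  rewrite -/g (@le_lt_trans _ _ m%:R^-1)//.
    by rewrite -[leLHS]invrK lef_pV2 ?posrE// invr_gt0.
  by rewrite -[ltLHS]mulr1 ltr_pdivrMl.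
have h1 : G z <= G (b m * (theta / 2)) by apply: G_nonincreasing; lra.
have m20 : (0 : R) < m.+1%:R by rewrite ltr0n.
rewrite -(ler_pM2l m20).
apply: (le_trans (_ : _ <= m.+1%:R * G (b m * (theta / 2)))); first by rewrite ler_pM2l.
apply: (le_trans (ltW hm2)).
rewrite mulrCA -[leLHS]mulr1 ler_pM2l// -/g.
by move: m2; rewrite -[ltLHS]mul1r ltr_pdivrMr// => /ltW.
Unshelve. all: by end_near. Qed.

(** Karamata's bound, for [h c] the mean of a nonnegative variable with tail [G]
    truncated at [c], by induction along dyadic levels rather than by
    integration: if [h c <= C * (c * G c)] then, by doubling,
    [h (2 * c) <= (C + 1) * (q / 2) * (2 * c * G (2 * c))], and the factor
    [(C + 1) * (q / 2)] is at most [C] for [C] large because [q < 2]. *)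
Lemma truncated_mean_le (h : R -> R) : beta < 1 ->
  (forall c, 0 <= c -> h c <= c) ->
  (forall c, 0 <= c -> h (2 * c) <= h c + c * G c) ->
  exists2 C, 0 < C & exists2 z0, 0 < z0 & forall c, z0 <= c -> h c <= C * (c * G c).
Proof.
move=> beta1 hc h2c.
have [q [q1 q2]] : exists q : R, 2 `^ beta < q /\ q < 2.
  have h2 : (2 : R) `^ beta < 2.
    rewrite -[ltRHS]lnK ?posrE// /powR gt_eqF// ltr_expR.
    by rewrite gtr_pMl// ln_gt0// ltr1n.
  by exists ((2 `^ beta + 2) / 2); split; lra.
have q0 : 0 < q by apply: lt_trans q1; exact: powR_gt0.
have [z0 z00 hz0] := rv_doubling q1.
have G2 := rv_tail_gt0 (2 * z0).
pose C := Num.max (q / (2 - q)) (G (2 * z0))^-1.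
have C1 : q <= C * (2 - q) by rewrite -ler_pdivrMr ?le_max ?lexx//; lra.
have C2 : 1 <= C * G (2 * z0).
  by rewrite -ler_pdivrMr// div1r le_max lexx orbT.
have C0 : 0 < C by rewrite lt_max invr_gt0 G2 orbT.
exists C => //; exists z0 => //.
have step k : forall c, z0 <= c -> c <= 2 ^+ k * (2 * z0) -> h c <= C * (c * G c).
  elim: k => [|k ih] c z0c ck.
    have c0 : 0 < c by exact: lt_le_trans z0c.
    apply: le_trans (hc _ (ltW c0)) _; rewrite mulrCA -[leLHS]mulr1 ler_pM2l//.
    apply: le_trans C2 _; rewrite ler_pM2l//; apply: G_nonincreasing.
    by rewrite mul1r in ck.
  have [c2z|c2z] := leP c (2 * z0); first by apply: (ih c) => //; apply: le_trans c2z _;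
    rewrite ler_peMl ?exprn_ege1//; lra.
  pose c' := c / 2.
  have cE : c = 2 * c' by rewrite /c'; field.
  have z0c' : z0 <= c' by rewrite /c'; lra.
  have c'0 : 0 < c' by exact: lt_le_trans z0c'.
  have {}ih : h c' <= C * (c' * G c').
    by apply: ih => //; move: ck; rewrite exprS cE -mulrA ler_pM2l.
  have := h2c _ (ltW c'0); rewrite -cE => /le_trans; apply.
  apply: (@le_trans _ _ ((C + 1) * (c' * (q * G (2 * c'))))).
    apply: (@le_trans _ _ ((C + 1) * (c' * G c'))); first by lra.
    rewrite ler_pM2l; last by lra.
    by rewrite ler_pM2l//; exact: hz0.
  rewrite -cE {2}cE.
  rewrite [leLHS](_ : _ = ((C + 1) * q) * (c' * G c)); last by ring.
  rewrite [leRHS](_ : _ = (2 * C) * (c' * G c)); last by ring.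
  rewrite ler_wpM2r//; last by lra.
  by rewrite mulr_ge0 ?ltW// rv_tail_gt0.
move=> c z0c.
have [k hk] : exists k : nat, c / (2 * z0) <= 2 ^+ k.
  exists (Num.truncn (c / (2 * z0))).+1; apply: ltW.
  apply: lt_trans (truncnS_gt _) _.
  by rewrite -natrX ltr_nat; exact: ltn_expl.
by apply: (step k) => //; rewrite -ler_pdivrMr//; lra.
Qed.

Lemma truncated_mean_scaled (h : R -> R) : beta < 1 ->
  (forall c, 0 <= c -> h c <= c) ->
  (forall c, 0 <= c -> h (2 * c) <= h c + c * G c) ->
  exists2 C, 0 < C & forall eps, 0 < eps ->
    \forall n \near \oo, n%:R * h (eps * b n) <= C * eps `^ (1 - beta) * b n.
Proof.
move=> beta1 hc h2c.
have [C C0 [z0 z00 hC]] := truncated_mean_le beta1 hc h2c.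
exists (2 * C) => [|eps eps0]; first by rewrite mulr_gt0.
near=> n.
have bn : z0 / eps < b n by near: n; exact: rv_scale_infty.
have bn0 : 0 < b n by near: n.
have h1 : h (eps * b n) <= C * (eps * b n * G (eps * b n)).
  by apply: hC; rewrite mulrC -ler_pdivrMr// ltW.
have h2 : n%:R * G (b n * eps) <= 2 * eps `^ (- beta).
  near: n; apply: cvgr_le (cvgG eps0) _ _.
  have := powR_gt0 (- beta) eps0; lra.
apply: le_trans (ler_wpM2l (ler0n _ n) h1) _.
have -> : eps `^ (1 - beta) = eps * eps `^ (- beta).
  rewrite powRD ?powRr1 ?(ltW eps0)//.
  by apply/implyP => _; rewrite gt_eqF.
rewrite [leLHS](_ : _ = (C * eps * b n) * (n%:R * G (b n * eps))); last first.
  by rewrite [eps * b n]mulrC; ring.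
rewrite [leRHS](_ : _ = (C * eps * b n) * (2 * eps `^ (- beta))); last by ring.
by rewrite ler_wpM2l// !mulr_ge0// ltW.
Unshelve. all: by end_near. Qed.

End RegularVariation.

(** * Variables with asymptotically equal tails *)

Section ProbabilityFacts.
Context {R : realType} {d : measure_display} {T : measurableType d}.
Implicit Types (f g : T -> R) (A B : set T).

Lemma measurable_set_lt f g :
  measurable_fun setT f -> measurable_fun setT g ->
  measurable [set w | f w < g w].
Proof.
move=> mf mg; rewrite -[X in measurable X]setTI.
exact: (measurable_fun_ltr mf mg).
Qed.

Lemma measurable_set_le f g :
  measurable_fun setT f -> measurable_fun setT g ->
  measurable [set w | f w <= g w].
Proof.
move=> mf mg; rewrite -[X in measurable X]setTI.
exact: (measurable_fun_ler mf mg).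
Qed.

Lemma finite_exists_measurable (I : finType) (F : I -> set T) :
  (forall i, measurable (F i)) -> measurable [set w | exists i, F i w].
Proof.
move=> mF; rewrite (_ : [set w | _] = \bigcup_(i in [set: I]) F i).
  by apply: fin_bigcup_measurable => //; exact: finite_finset.
by apply/seteqP; split=> w [i]; [exists i | move=> _ ?; exists i].
Qed.

Variable P : probability T R.

Lemma fine_prob_ge0 A : 0 <= fine (P A).
Proof. by rewrite fine_ge0. Qed.

Lemma fine_probE A : measurable A -> P A = (fine (P A))%:E.
Proof. by move=> mA; rewrite fineK// fin_num_measure. Qed.

Lemma fine_prob_le A B : measurable A -> measurable B -> A `<=` B ->
  fine (P A) <= fine (P B).
Proof.
move=> mA mB AB; rewrite -lee_fin -!fine_probE//.
by apply: le_measure => //; rewrite inE.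
Qed.

Lemma fine_probU_le A B : measurable A -> measurable B ->
  fine (P (A `|` B)) <= fine (P A) + fine (P B).
Proof.
move=> mA mB; rewrite -lee_fin EFinD -!fine_probE//; last exact: measurableU.
exact: measureU2.
Qed.

Lemma fine_prob_exists_le (I : finType) (F : I -> set T) :
  (forall i, measurable (F i)) ->
  fine (P [set w | exists i, F i w]) <= \sum_i fine (P (F i)).
Proof.
move=> mF.
have h (s : seq I) : measurable [set w | exists2 i, i \in s & F i w] /\
    fine (P [set w | exists2 i, i \in s & F i w]) <= \sum_(i <- s) fine (P (F i)).
  elim: s => [|i s [mS ih]].
    rewrite (_ : [set w | _] = set0) ?measure0 ?big_nil//.
    by apply/seteqP; split=> w // [].
  rewrite (_ : [set w | _] = F i `|` [set w | exists2 i, i \in s & F i w]).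
    split; first exact: measurableU.
    by rewrite big_cons (le_trans (fine_probU_le (mF i) mS))// lerD2l.
  apply/seteqP; split=> w /=.
    by move=> [j]; rewrite inE => /predU1P[->|js]; [left | right; exists j].
  by move=> [wi|[j js wj]]; [exists i | exists j] => //; rewrite inE ?eqxx ?js ?orbT.
have [_ ] := h (index_enum I); apply: le_trans.
rewrite le_eqVlt; apply/orP; left; apply/eqP; congr (fine (P _)).
by apply/seteqP; split=> w [i]; [move=> ?; exists i | move=> _ ?; exists i].
Qed.

Lemma fine_probD A B : measurable A -> measurable B -> A `<=` B ->
  fine (P (B `\` A)) = fine (P B) - fine (P A).
Proof.
move=> mA mB AB; rewrite measureD//; last by rewrite ltey_eq fin_num_measure.
by rewrite setIidr// fineB ?fin_num_measure.
Qed.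

Lemma fine_probC A : measurable A -> fine (P (~` A)) = 1 - fine (P A).
Proof. by move=> mA; rewrite probability_setC// fineB ?fin_num_measure. Qed.

End ProbabilityFacts.

Section VanishingSequences.
Context {R : realType}.

Lemma cvg0_le (u : nat -> R) : (forall n, 0 <= u n) ->
  (forall e, 0 < e -> \forall n \near \oo, u n <= e) -> u @ \oo --> 0.
Proof.
move=> u0 h; apply/cvgrPdist_le => e e0; near=> n.
by rewrite sub0r normrN ger0_norm//; near: n; exact: h.
Unshelve. all: by end_near. Qed.

Lemma cvg_of_eventual_bounds (u : nat -> R) (l : R) :
  (forall e, 0 < e -> \forall n \near \oo, u n <= l + e) ->
  (forall e, 0 < e -> \forall n \near \oo, l - e <= u n) -> u @ \oo --> l.
Proof.
move=> hu hl; apply/cvgrPdist_le => e e0; near=> n.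
rewrite ler_distlC; apply/andP; split; near: n; [exact: hl | exact: hu].
Unshelve. all: by end_near. Qed.

End VanishingSequences.

Section OneBigJump.
Context {R : realType} {d : measure_display} {T : measurableType d}.
Variables (P : probability T R) (p : nat -> nat) (B : nat -> R) (beta : R).
Variables (U V W : nat -> T -> R).
Hypothesis beta0 : 0 < beta.
Hypothesis B_gt0 : \forall n \near \oo, 0 < B n.
Hypothesis mU : forall n, measurable_fun setT (U n).
Hypothesis mV : forall n, measurable_fun setT (V n).
Hypothesis V_ge0 : forall n w, 0 <= V n w.
Hypothesis VU : forall n w, V n w <= U n w.
Hypothesis cvgU : forall z, 0 < z ->
  (fun n => (p n)%:R * fine (P [set w | B n * z < U n w])) @ \oo --> z `^ (- beta).
Hypothesis cvgV : forall z, 0 < z ->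
  (fun n => (p n)%:R * fine (P [set w | B n * z < V n w])) @ \oo --> z `^ (- beta).

Let measU n z : measurable [set w | B n * z < U n w].
Proof. by apply: measurable_set_lt. Qed.
Let measV n z : measurable [set w | B n * z < V n w].
Proof. by apply: measurable_set_lt. Qed.

(** Two nested variables with the same tail asymptotics cannot be separated at
    the scale [B]: a gap [gamma * B <= U - V] would put a grid point
    [k * gamma / 2] between them, and each such event has the difference of
    two tails with the same limit as its probability. *)
Lemma gap_negligible (gamma : R) : 0 < gamma ->
  (fun n => (p n)%:R * fine (P [set w | gamma * B n <= U n w - V n w])) @ \oo --> 0.
Proof.
move=> g0.
apply: cvg0_le => [n|e e0]; first by rewrite mulr_ge0// fine_prob_ge0.
pose y (k : nat) := k%:R * (gamma / 2).
have [L L0 hL] : exists2 L, (0 < L)%N & y L `^ (- beta) < e / 2.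
  have e2 : 0 < e / 4 by lra.
  pose x := (e / 4) `^ (- beta)^-1.
  have nb : - beta != 0 by rewrite oppr_eq0 gt_eqF.
  have hx : x `^ (- beta) = e / 4 by exact: powR_root.
  have x0 : 0 < x := powR_gt0 _ e2.
  exists (Num.truncn (x / (gamma / 2))).+1 => //.
  apply: (@le_lt_trans _ _ (x `^ (- beta))); last by rewrite hx; lra.
  apply: le_powRN => //; rewrite -ler_pdivrMr; last by lra.
  exact/ltW/truncnS_gt.
have yL0 : 0 < y L by rewrite mulr_gt0 ?ltr0n//; lra.
have y0 k : 0 < y k.+1 by rewrite mulr_gt0// ?ltr0n//; lra.
pose D n k := [set w | B n * y k < U n w] `\` [set w | B n * y k < V n w].
have mD n k : measurable (D n k) by exact: measurableD.
have cD (k : 'I_L) : (fun n => (p n)%:R * fine (P (D n k.+1))) @ \oo --> (0 : R).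
  rewrite -[X in _ --> X](subrr (y k.+1 `^ (- beta))).
  have E n : (p n)%:R * fine (P (D n k.+1)) =
      (p n)%:R * fine (P [set w | B n * y k.+1 < U n w])
      - (p n)%:R * fine (P [set w | B n * y k.+1 < V n w]).
    rewrite /D fine_probD ?mulrBr// => w /= h.
    exact: lt_le_trans (VU _ _).
  by under eq_fun do rewrite E; apply: cvgB; [exact: cvgU | exact: cvgV].
have := cvg_sum_fin (r := index_enum 'I_L) cD; rewrite big1// => cS.
near=> n; have Bn : 0 < B n by near: n.
have h1 : (p n)%:R * fine (P [set w | B n * y L < U n w]) <= e / 2.
  by near: n; apply: cvgr_le (cvgU yL0) _ hL.
have h2 : \sum_(k < L) (p n)%:R * fine (P (D n k.+1)) <= e / 2.
  by near: n; apply: cvgr_le cS _ _; lra.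
have sub : [set w | gamma * B n <= U n w - V n w] `<=`
    [set w | B n * y L < U n w] `|` [set w | exists k : 'I_L, D n k.+1 w].
  move=> w /= gap; have [UL|UL] := ltP (B n * y L) (U n w); [by left | right].
  have s0 : 0 < B n * (gamma / 2) by rewrite mulr_gt0//; lra.
  (* [k.+1] and not [k], so that the grid point is positive even if [V] is [0] *)
  pose k := Num.truncn (V n w / (B n * (gamma / 2))).
  have /andP[k1 k2] := truncn_itv (divr_ge0 (V_ge0 n w) (ltW s0)).
  rewrite -/k ler_pdivlMr// ltr_pdivrMr// in k1 k2.
  have yU : B n * y k.+1 < U n w.
    rewrite /y -natr1; lra.
  have kL : (k < L)%N.
    have : B n * y k.+1 < B n * y L by exact: lt_le_trans UL.
    rewrite ltr_pM2l// /y ltr_pM2r ?ltr_nat; last by lra.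
    exact: ltnW.
  exists (Ordinal kL); split=> //=.
  by apply/negP; rewrite -leNgt; apply: ltW; rewrite mulrCA.
have mE : measurable [set w | exists k : 'I_L, D n k.+1 w].
  by apply: finite_exists_measurable => k; exact: mD.
apply: (@le_trans _ _ ((p n)%:R * (fine (P [set w | B n * y L < U n w]) +
   \sum_(k < L) fine (P (D n k.+1))))).
  rewrite ler_wpM2l//; apply: le_trans (lerD (lexx _) (fine_prob_exists_le _ _)).
    apply: le_trans (fine_probU_le _ _ _) => //.
    apply: fine_prob_le => //; last exact: measurableU.
    by apply: measurable_set_le => //; exact: measurable_funB.
  by move=> k; exact: mD.
by rewrite mulrDr mulr_sumr [leRHS](splitr e) lerD.
Unshelve. all: by end_near. Qed.

Hypothesis mW : forall n, measurable_fun setT (W n).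
Hypothesis WV : forall n w, W n w <= V n w.
Hypothesis VWU : forall n w, V n w - W n w <= U n w - V n w.

(** When [V] exceeds [B * (z + g)], either [W] exceeds [B * z] or [V - W], hence
    the gap, is at least [g * B]; the second case is negligible and [g] is
    arbitrary. *)
Lemma gap_cvg_tail (z : R) : 0 < z ->
  (fun n => (p n)%:R * fine (P [set w | B n * z < W n w])) @ \oo --> z `^ (- beta).
Proof.
move=> z0.
have measW n : measurable [set w | B n * z < W n w] by exact: measurable_set_lt.
apply: cvg_of_eventual_bounds => e e0.
  near=> n; apply: (@le_trans _ _ ((p n)%:R * fine (P [set w | B n * z < V n w]))).
    rewrite ler_wpM2l//; apply: fine_prob_le => // w /= h.
    exact: lt_le_trans (WV _ _).
  by near: n; apply: cvgr_le (cvgV z0) _ _; rewrite ltrDl.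
have [g g0 hg] : exists2 g, 0 < g & z `^ (- beta) - e / 2 < (z + g) `^ (- beta).
  have lt_z : z `^ (- beta) - e / 2 < z `^ (- beta) by lra.
  have : \forall y \near z, z `^ (- beta) - e / 2 < y `^ (- beta).
    exact: cvgr_gt (cvg_powR z0) _ lt_z.
  move=> /nbhs_ballP[r /= r0 hr]; exists (r / 2); first by lra.
  by apply: hr; rewrite /ball/= opprD addNKr normrN gtr0_norm; lra.
near=> n.
have h1 : z `^ (- beta) - e / 2 <= (p n)%:R * fine (P [set w | B n * (z + g) < V n w]).
  by near: n; apply: cvgr_ge (cvgV _) _ hg; lra.
have h2 : (p n)%:R * fine (P [set w | g * B n <= U n w - V n w]) <= e / 2.
  by near: n; apply: cvgr_le (gap_negligible g0) _ _; lra.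
have mG : measurable [set w | g * B n <= U n w - V n w].
  by apply: measurable_set_le => //; exact: measurable_funB.
have : fine (P [set w | B n * (z + g) < V n w]) <=
    fine (P [set w | B n * z < W n w]) + fine (P [set w | g * B n <= U n w - V n w]).
  apply: le_trans (fine_probU_le _ _ _) => //.
  apply: fine_prob_le => //; first exact: measurableU.
  move=> w /= hV; have [hW|hW] := ltP (B n * z) (W n w); [by left | right].
  by have := VWU n w; lra.
move=> /(ler_wpM2l (ler0n R (p n))); rewrite [leRHS]mulrDr => h; lra.
Unshelve. all: by end_near. Qed.

End OneBigJump.

(** * Truncated means and row functionals *)

Section TruncatedMean.
Context {R : realType} {d : measure_display} {T : measurableType d}.
Variables (P : probability T R) (X : {RV P >-> R}).

Definition sq_tail (z : R) : R := fine (P [set w | z < X w ^+ 2]).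

Definition truncated_sq_mean (c : R) : R :=
  fine (\int[P]_w (Num.min (X w ^+ 2) c)%:E).

Lemma measurable_sqr_RV : measurable_fun setT (fun w => X w ^+ 2).
Proof. exact: measurable_funX. Qed.

Lemma measurable_sq_tail_set z : measurable [set w | z < X w ^+ 2].
Proof. by apply: measurable_set_lt => //; exact: measurable_sqr_RV. Qed.

Lemma measurable_min_sqr c :
  measurable_fun setT (fun w => (Num.min (X w ^+ 2) c)%:E).
Proof.
apply/measurable_EFinP; apply: (measurable_minr (f := fun w => X w ^+ 2) (g := cst c)) => //.
exact: measurable_sqr_RV.
Qed.

Lemma sq_tail_nonincreasing x y : x <= y -> sq_tail y <= sq_tail x.
Proof.
move=> xy; apply: fine_prob_le; [exact: measurable_sq_tail_set.. | move=> w /=].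
exact: le_lt_trans.
Qed.

Lemma min_sqr_ge0 c w : 0 <= c -> (0 <= (Num.min (X w ^+ 2) c)%:E)%E.
Proof. by move=> c0; rewrite lee_fin le_min sqr_ge0. Qed.

Let truncated_int_le c : 0 <= c -> (\int[P]_w (Num.min (X w ^+ 2) c)%:E <= c%:E)%E.
Proof.
move=> c0; rewrite [leRHS](_ : _ = \int[P]_w (cst c%:E w))%E; last first.
  by rewrite integral_cst//= probability_setT mule1.
apply: (@ge0_le_integral _ _ _ P setT) => //.
- by move=> w _; exact: min_sqr_ge0.
- exact: measurable_min_sqr.
- by move=> w _; rewrite lee_fin ge_min lexx orbT.
Qed.

Lemma truncated_sq_meanE c : 0 <= c ->
  (\int[P]_w (Num.min (X w ^+ 2) c)%:E)%E = (truncated_sq_mean c)%:E.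
Proof.
move=> c0; rewrite fineK// ge0_fin_numE.
  by apply: le_lt_trans (truncated_int_le c0) _; rewrite ltry.
by apply: integral_ge0 => w _; exact: min_sqr_ge0.
Qed.

Lemma truncated_sq_mean_le c : 0 <= c -> truncated_sq_mean c <= c.
Proof. by move=> c0; rewrite -lee_fin -truncated_sq_meanE// truncated_int_le. Qed.

(** Pointwise, [min(Y, 2 c) <= min(Y, c) + c * 1_(Y > c)]. *)
Lemma truncated_sq_mean_double c : 0 <= c ->
  truncated_sq_mean (2 * c) <= truncated_sq_mean c + c * sq_tail c.
Proof.
move=> c0; have c20 : 0 <= 2 * c by rewrite mulr_ge0.
have mA := measurable_sq_tail_set c.
rewrite -lee_fin EFinD EFinM -!truncated_sq_meanE// /sq_tail -fine_probE//.
have mI : measurable_fun setT (fun w => c%:E * (\1_[set w | (c < X w ^+ 2)%R] w)%:E)%E.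
  apply: emeasurable_funM => //; apply/measurable_EFinP; exact: measurable_indic.
have -> : (c%:E * P [set w | (c < X w ^+ 2)%R])%E =
    (\int[P]_w (c%:E * (\1_[set w | (c < X w ^+ 2)%R] w)%:E))%E.
  rewrite ge0_integralZl//.
  - by rewrite integral_indic// setIT.
  - by apply/measurable_EFinP; exact: measurable_indic.
rewrite -ge0_integralD//.
- apply: (@ge0_le_integral _ _ _ P setT) => //.
  + by move=> w _; exact: min_sqr_ge0.
  + exact: measurable_min_sqr.
  + by apply: emeasurable_funD => //; exact: measurable_min_sqr.
  + move=> w _; rewrite -EFinM -EFinD lee_fin indicE.
    have [cX|Xc] := ltP c (X w ^+ 2).
      rewrite mem_set// mulr1 ge_min; apply/orP; right; lra.
    rewrite memNset ?mulr0 ?addr0//=; last by apply/negP; rewrite -leNgt.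
    by rewrite ge_min lexx.
- by move=> w _; exact: min_sqr_ge0.
- exact: measurable_min_sqr.
- by move=> w _; rewrite -EFinM lee_fin mulr_ge0.
Qed.

End TruncatedMean.

Section RowFunctionals.
Context {R : realType} (n : nat).
Implicit Types x : n.-tuple R.

Definition row_sum_abs x : R := \sum_(t < n) `|tnth x t|.
Definition row_sum_sqr x : R := \sum_(t < n) tnth x t ^+ 2.
Definition row_max_sqr x : R := \big[Num.max/0]_(t < n) tnth x t ^+ 2.

Lemma measurable_row_sum_abs : measurable_fun setT row_sum_abs.
Proof.
apply: measurable_sum => t.
by apply: measurableT_comp => //; exact: measurable_tnth.
Qed.

Lemma measurable_row_sum_sqr : measurable_fun setT row_sum_sqr.
Proof. by apply: measurable_sum => t; apply: measurable_funX; exact: measurable_tnth. Qed.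

Lemma measurable_row_max_sqr : measurable_fun setT row_max_sqr.
Proof.
rewrite /row_max_sqr; elim: (index_enum _) => [|t s ih].
  by under eq_fun do rewrite big_nil; exact: measurable_cst.
under eq_fun do rewrite big_cons.
by apply: measurable_maxr => //; apply: measurable_funX; exact: measurable_tnth.
Qed.

Lemma row_sum_abs_ge0 x : 0 <= row_sum_abs x.
Proof. by apply: sumr_ge0. Qed.

Lemma row_sum_sqr_ge0 x : 0 <= row_sum_sqr x.
Proof. by apply: sumr_ge0 => t _; exact: sqr_ge0. Qed.

Lemma le_row_sum_abs x t : `|tnth x t| <= row_sum_abs x.
Proof. by rewrite /row_sum_abs (bigD1 t)//= lerDl; apply: sumr_ge0. Qed.

Lemma row_sum_sqr_le_sqr_sum x : row_sum_sqr x <= row_sum_abs x ^+ 2.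
Proof.
rewrite expr2 {1}/row_sum_abs mulr_suml; apply: ler_sum => t _.
by rewrite -real_normK ?num_real// expr2 ler_wpM2l// le_row_sum_abs.
Qed.

Lemma row_max_sqr_le_sum x : row_max_sqr x <= row_sum_sqr x.
Proof.
apply/bigmax_leP; split=> [|t _]; first exact: row_sum_sqr_ge0.
rewrite /row_sum_sqr (bigD1 t)//= lerDl.
by apply: sumr_ge0 => s _; exact: sqr_ge0.
Qed.

(** With [S1], [S2] and [m ^+ 2] for the three functionals, this follows from
    [S2 <= m * S1] and [m <= S1]. *)
Lemma row_sum_sqr_sub_max_le x :
  row_sum_sqr x - row_max_sqr x <= row_sum_abs x ^+ 2 - row_sum_sqr x.
Proof.
pose m := \big[Num.max/0]_(t < n) `|tnth x t|.
have m0 : 0 <= m by exact: bigmax_ge_id.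
have mt t : `|tnth x t| <= m by exact: (le_bigmax 0 (fun t => `|tnth x t|) t).
have m_sqr : m ^+ 2 <= row_max_sqr x.
  have M0 : 0 <= row_max_sqr x by exact: bigmax_ge_id.
  rewrite -[leRHS]sqr_sqrtr//; apply: lerXn2r; rewrite ?nnegrE ?sqrtr_ge0//.
  apply/bigmax_leP; split=> [|t _]; first exact: sqrtr_ge0.
  rewrite -sqrtr_sqr; apply: ler_wsqrtr.
  exact: (le_bigmax 0 (fun t => tnth x t ^+ 2) t).
have S2m : row_sum_sqr x <= m * row_sum_abs x.
  rewrite /row_sum_abs mulr_sumr; apply: ler_sum => t _.
  by rewrite -real_normK ?num_real// expr2 ler_wpM2r.
have mS1 : m <= row_sum_abs x.
  apply/bigmax_leP; split=> [|t _]; first exact: row_sum_abs_ge0.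
  exact: le_row_sum_abs.
have S10 := row_sum_abs_ge0 x.
nra.
Qed.

(** The gap between the squared sum and the sum of squares is the sum of the
    products of the absolute values over the pairs of distinct indices. *)
Lemma row_gap_of_two_large x (c : R) s t : 0 <= c -> s != t ->
  c < tnth x s ^+ 2 -> c < tnth x t ^+ 2 ->
  c <= row_sum_abs x ^+ 2 - row_sum_sqr x.
Proof.
move=> c0 st hs ht; set y := fun i => `|tnth x i|.
have y0 i : 0 <= y i by exact: normr_ge0.
have E : row_sum_sqr x = \sum_i y i ^+ 2.
  by apply: eq_bigr => i _; rewrite /y real_normK ?num_real.
have ys : c < y s ^+ 2 by rewrite /y real_normK ?num_real.
have yt : c < y t ^+ 2 by rewrite /y real_normK ?num_real.
have -> : row_sum_abs x ^+ 2 - row_sum_sqr x = \sum_i y i * (row_sum_abs x - y i).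
  rewrite E expr2 {1}/row_sum_abs mulr_suml -sumrB.
  by apply: eq_bigr => i _; rewrite mulrBr expr2.
have cst : c <= y s * y t.
  rewrite -(@ler_pXn2r _ 2) ?nnegrE ?mulr_ge0// exprMn expr2.
  by apply: ler_pM => //; exact: ltW.
have rest i : 0 <= row_sum_abs x - y i by rewrite subr_ge0 le_row_sum_abs.
rewrite (bigD1 s)//= (le_trans cst)// ler_wpDr//.
  by apply: sumr_ge0 => i _; rewrite mulr_ge0.
rewrite ler_wpM2l// /row_sum_abs (bigD1 s)//= -/(y s) [leRHS]addrAC subrr add0r.
by rewrite (bigD1 t)//= 1?eq_sym// lerDl; apply: sumr_ge0.
Qed.

End RowFunctionals.

(** * Exceptional events of a random matrix with independent rows *)

Section RandomMatrix.
Context {R : realType} {d dO : measure_display}.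
Context {T : measurableType d} {Om : measurableType dO}.
Variables (P : probability T R) (Q : probability Om R) (m n : nat).
Variables (X0 : {RV P >-> R}) (Z : 'I_n -> {RV P >-> R}).
Variable (XM : 'I_m -> 'I_n -> {RV Q >-> R}).

Let row (w : T) : n.-tuple R := [tuple Z t w | t < n].
Let rowM i (w : Om) : n.-tuple R := [tuple XM i t w | t < n].
Let M (w : Om) : 'M[R]_(m, n) := \matrix_(i < m, t < n) XM i t w.

Hypothesis same_marginals : forall t, same_law P P (Z t) X0.
Hypothesis independent_rows : mutually_independent Q rowM.
Hypothesis row_law : forall i, same_law Q P (rowM i) row.

Lemma measurable_row : measurable_fun setT row.
Proof.
apply/measurable_fun_tnthP => t; rewrite (_ : _ \o _ = Z t)//.
by apply/funext => w /=; rewrite tnth_mktuple.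
Qed.

Lemma measurable_rowM i : measurable_fun setT (rowM i).
Proof.
apply/measurable_fun_tnthP => t; rewrite (_ : _ \o _ = XM i t)//.
by apply/funext => w /=; rewrite tnth_mktuple.
Qed.

Lemma measurable_rowM_preimage i A : measurable A -> measurable (rowM i @^-1` A).
Proof. by move=> mA; rewrite -[X in measurable X]setTI; exact: measurable_rowM. Qed.

Lemma measurable_tnth_preimage t (A : set R) : measurable A ->
  measurable [set x : n.-tuple R | A (tnth x t)].
Proof.
move=> mA; rewrite -[X in measurable X]setTI.
exact: (measurable_tnth (d := _) (T := R) (n := n) t).
Qed.

Lemma entry_law i t : same_law Q P (XM i t) X0.
Proof.
move=> A mA; rewrite -(same_marginals t mA).
have mA' := measurable_tnth_preimage t mA.
have := row_law i mA'.
rewrite (_ : rowM i @^-1` _ = XM i t @^-1` A); last first.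
  by apply/seteqP; split=> w; rewrite /= tnth_mktuple.
by rewrite (_ : row @^-1` _ = Z t @^-1` A)//;
  apply/seteqP; split=> w; rewrite /= tnth_mktuple.
Qed.

Lemma entry_sq_tail i t z : sq_tail (XM i t) z = sq_tail X0 z.
Proof.
rewrite /sq_tail; congr fine.
have mA : measurable [set x : R | z < x ^+ 2].
  by apply: measurable_set_lt => //; exact: measurable_funX.
exact: (entry_law i t mA).
Qed.

Lemma entry_truncated_sq_mean i t c : 0 <= c ->
  truncated_sq_mean (XM i t) c = truncated_sq_mean X0 c.
Proof.
move=> c0; rewrite /truncated_sq_mean; congr fine.
pose f (x : R) := (Num.min (x ^+ 2) c)%:E.
have mf : measurable_fun setT f.
  have mx : measurable_fun [set: R] (fun x : R => x ^+ 2) by exact: exprn_measurable.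
  have mc : measurable_fun [set: R] (cst c) by exact: measurable_cst.
  by apply/measurable_EFinP; exact: (measurable_minr mx mc).
have f0 x : (0 <= f x)%E by rewrite lee_fin le_min sqr_ge0.
rewrite -(ge0_integral_distribution (XM i t) mf f0).
rewrite -(ge0_integral_distribution X0 mf f0).
by apply: eq_measure_integral => A mA _; exact: entry_law.
Qed.

Lemma measurable_M i t : measurable_fun setT (fun w => M w i t).
Proof. by under eq_fun do rewrite mxE; exact: measurable_funP. Qed.

Lemma prob_max_sqr_entry_le y : 0 <= y ->
  fine (Q [set w | max_sqr_entry (M w) <= y]) =
  (1 - fine (P [set w | y < row_max_sqr (row w)])) ^+ m.
Proof.
move=> y0; pose A := [set x : n.-tuple R | row_max_sqr x <= y].
have mA : measurable A by apply: measurable_set_le => //; exact: measurable_row_max_sqr.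
have := independent_rows [set: 'I_m]%SET (fun=> mA).
rewrite (_ : [set w | _] = [set w | max_sqr_entry (M w) <= y]); last first.
  apply/seteqP; split=> w /=.
    move=> h; apply/(max_sqr_entry_leP _ y0) => i t; rewrite mxE.
    have /bigmax_leP[_ /(_ t isT)] := h i (finset.in_setT i).
    by rewrite tnth_mktuple.
  move=> /(max_sqr_entry_leP _ y0) h i _; apply/bigmax_leP; split=> // t _.
  by have := h i t; rewrite mxE tnth_mktuple.
move=> ->; rewrite (eq_bigr (fun=> 1 - fine (P [set w | y < row_max_sqr (row w)]))).
  by rewrite prodr_const cardsT card_ord.
move=> i _; rewrite row_law// -fine_probC; last first.
  apply: measurable_set_lt => //; apply: measurableT_comp measurable_row.
  exact: measurable_row_max_sqr.
congr (fine (P _)); apply/seteqP; split=> w /=; rewrite /A /=.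
  by rewrite leNgt => /negP.
by move=> h; rewrite leNgt; apply/negP.
Qed.

(** Expressed by the gap of a row, whose probability is controlled by the tails
    of row sums; by [row_gap_of_two_large] it covers every row with two entries
    whose squares exceed [c]. *)
Definition two_large_in_row (c : R) : set Om :=
  [set w | exists i, c <= row_sum_abs (rowM i w) ^+ 2 - row_sum_sqr (rowM i w)].

Let gap_set (c : R) := [set x : n.-tuple R | c <= row_sum_abs x ^+ 2 - row_sum_sqr x].

Let measurable_gap_set c : measurable (gap_set c).
Proof.
apply: measurable_set_le => //; apply: measurable_funB; last exact: measurable_row_sum_sqr.
by apply: measurable_funX; exact: measurable_row_sum_abs.
Qed.

Lemma measurable_two_large_in_row c : measurable (two_large_in_row c).
Proof.
apply: finite_exists_measurable => i.
exact: (measurable_rowM_preimage i (measurable_gap_set c)).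
Qed.

Lemma prob_two_large_in_row c : fine (Q (two_large_in_row c)) <=
  m%:R * fine (P [set w | c <= row_sum_abs (row w) ^+ 2 - row_sum_sqr (row w)]).
Proof.
apply: le_trans (fine_prob_exists_le _ _) _ => [i|].
  exact: (measurable_rowM_preimage i (measurable_gap_set c)).
rewrite (eq_bigr (fun=> fine (P (row @^-1` gap_set c)))) => [|i _].
  by rewrite sumr_const card_ord mulr_natl.
congr fine; exact: (row_law i (measurable_gap_set c)).
Qed.

(** The index [u] is a column followed by a pair of rows. *)
Definition two_large_in_column (c : R) : set Om :=
  [set w | exists u : 'I_n * ('I_m * 'I_m), u.2.1 != u.2.2 /\
    (c < XM u.2.1 u.1 w ^+ 2 /\ c < XM u.2.2 u.1 w ^+ 2)].

Let measurable_two_entries c i j t :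
  measurable [set w | c < XM i t w ^+ 2 /\ c < XM j t w ^+ 2].
Proof. by apply: measurableI; exact: measurable_sq_tail_set. Qed.

Let measurable_column_event c (u : 'I_n * ('I_m * 'I_m)) :
  measurable [set w | u.2.1 != u.2.2 /\
    (c < XM u.2.1 u.1 w ^+ 2 /\ c < XM u.2.2 u.1 w ^+ 2)].
Proof.
case: (u.2.1 != u.2.2).
  rewrite (_ : [set w | _] = [set w | c < XM u.2.1 u.1 w ^+ 2 /\ c < XM u.2.2 u.1 w ^+ 2])//.
  by apply/seteqP; split=> w //= [].
rewrite (_ : [set w | _] = set0)//.
by apply/seteqP; split=> w //= [].
Qed.

Lemma measurable_two_large_in_column c : measurable (two_large_in_column c).
Proof. by apply: finite_exists_measurable => u; exact: measurable_column_event. Qed.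

Lemma prob_two_entries c t i j : i != j ->
  fine (Q [set w | c < XM i t w ^+ 2 /\ c < XM j t w ^+ 2]) = sq_tail X0 c ^+ 2.
Proof.
move=> ij; pose A := [set x : n.-tuple R | c < tnth x t ^+ 2].
have mA : measurable A.
  apply: measurable_set_lt => //; apply: measurable_funX; exact: measurable_tnth.
have AE k : rowM k @^-1` A = [set w | c < XM k t w ^+ 2].
  by apply/seteqP; split=> w; rewrite /A /= tnth_mktuple.
have := independent_rows [set i; j]%SET (fun=> mA).
rewrite big_setU1 ?finset.in_set1//= finset.big_set1 !AE.
rewrite -/(sq_tail (XM i t) c) -/(sq_tail (XM j t) c) !entry_sq_tail -expr2 => <-.
congr (fine (Q _)); apply/seteqP; split=> w /=.
  move=> [wi wj] k; rewrite finset.in_set2 => /orP[]/eqP ->;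
    by rewrite /A /= tnth_mktuple.
move=> h; have := h i; have := h j.
rewrite !finset.in_set2 !eqxx orbT => /(_ isT) + /(_ isT).
by rewrite /A /= !tnth_mktuple.
Qed.

Lemma prob_two_large_in_column c : fine (Q (two_large_in_column c)) <=
  (n * (m * m))%:R * sq_tail X0 c ^+ 2.
Proof.
apply: le_trans (fine_prob_exists_le _ (measurable_column_event c)) _.
apply: (@le_trans _ _ (\sum_(u : 'I_n * ('I_m * 'I_m)) sq_tail X0 c ^+ 2)).
  apply: ler_sum => -[t [i j]] _; have /= := measurable_column_event c (t, (i, j)).
  have [->|ij mE] := eqVneq i j.
    rewrite (_ : [set w | _] = set0) ?measure0 ?sqr_ge0//.
    by apply/seteqP; split=> w // -[].
  rewrite -(prob_two_entries c t ij); apply: fine_prob_le => //.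
  by move=> w /= [].
by rewrite sumr_const !card_prod !card_ord mulr_natl.
Qed.

Definition large_small_part (c kappa : R) : set Om :=
  [set w | kappa < \sum_i \sum_t Num.min (XM i t w ^+ 2) c].

Let measurable_small_part c :
  measurable_fun setT (fun w => \sum_i \sum_t Num.min (XM i t w ^+ 2) c).
Proof.
apply: measurable_sum => i; apply: measurable_sum => t.
exact/measurable_EFinP/measurable_min_sqr.
Qed.

Lemma measurable_large_small_part c kappa : measurable (large_small_part c kappa).
Proof. exact: measurable_set_lt. Qed.

(** Markov's inequality for the truncated Frobenius norm. *)
Lemma prob_large_small_part c kappa : 0 <= c -> 0 <= kappa ->
  kappa * fine (Q (large_small_part c kappa)) <=
  (n * m)%:R * truncated_sq_mean X0 c.
Proof.
move=> c0 k0; have mE := measurable_large_small_part c kappa.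
rewrite -lee_fin EFinM -fine_probE//.
have -> : (kappa%:E * Q (large_small_part c kappa))%E =
    (\int[Q]_w (kappa%:E * (\1_(large_small_part c kappa) w)%:E))%E.
  rewrite ge0_integralZl//.
  - by rewrite integral_indic// setIT.
  - by apply/measurable_EFinP; exact: measurable_indic.
have -> : ((n * m)%:R * truncated_sq_mean X0 c)%:E =
   (\int[Q]_w \sum_i \sum_t (Num.min (XM i t w ^+ 2) c)%:E)%E.
  rewrite ge0_integral_sum//; last first.
  - by move=> i w _; apply: sume_ge0 => t _; exact: min_sqr_ge0.
  - by move=> i; apply: emeasurable_sum => t; exact: measurable_min_sqr.
  under eq_bigr => i _.
    rewrite ge0_integral_sum//; last first.
    - by move=> t w _; exact: min_sqr_ge0.
    - by move=> t; exact: measurable_min_sqr.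
    under eq_bigr => t _ do rewrite truncated_sq_meanE// entry_truncated_sq_mean//.
    over.
  by rewrite !sumEFin !sumr_const !card_ord -mulrnA mulr_natl.
apply: (@ge0_le_integral _ _ _ Q setT) => //.
- by move=> w _; rewrite -EFinM lee_fin mulr_ge0.
- apply: emeasurable_funM => //; apply/measurable_EFinP; exact: measurable_indic.
- apply: emeasurable_sum => i; apply: emeasurable_sum => t.
  exact: measurable_min_sqr.
- move=> w _; under eq_bigr do rewrite sumEFin.
  rewrite sumEFin -EFinM lee_fin indicE.
  case: (boolP (w \in _)); last first.
    rewrite mulr0 => _; apply: sumr_ge0 => i _; apply: sumr_ge0 => t _.
    by rewrite le_min sqr_ge0.
  by rewrite inE mulr1 => /ltW.
Qed.

(** The three exceptional events are the obstructions to the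
    deterministic bound [max_eigenvalue_le_max_sqr_entry]. *)
Lemma max_eigenvalue_le_outside c kappa dl w : (0 < m)%N -> 0 <= c -> 0 < dl ->
  ~ two_large_in_row c w -> ~ two_large_in_column c w ->
  ~ large_small_part c kappa w ->
  max_eigenvalue (M w *m (M w)^T) <=
    (1 + dl) * max_sqr_entry (M w) + (1 + dl^-1) * kappa.
Proof.
move=> m0 c0 dl0 nrow ncol nsmall.
apply: (max_eigenvalue_le_max_sqr_entry (c := c)) => //.
- move=> i s t; rewrite !mxE => hs ht; apply: contrapT => /eqP st.
  apply: nrow; exists i; apply: (row_gap_of_two_large (s := s) (t := t)) => //;
  by rewrite tnth_mktuple.
- move=> t i j; rewrite !mxE => hi hj; apply: contrapT => /eqP ij.
  by apply: ncol; exists (t, (i, j)).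
- under eq_bigr do under eq_bigr do rewrite mxE.
  by rewrite leNgt; apply/negP.
Qed.

End RandomMatrix.

(** * Passage to the limit *)

Section SequenceTransfer.
Context {R : realType}.

Lemma cvg_near_eq (u v : nat -> R) (l : R) :
  (\forall n \near \oo, u n = v n) -> v @ \oo --> l -> u @ \oo --> l.
Proof.
move=> uv vl; apply: cvg_trans vl; apply: near_eq_cvg.
by near=> n; symmetry; near: n.
Unshelve. all: by end_near. Qed.

Lemma cvg_ratio_mul (p : nat -> nat) (s f : nat -> R) (l : R) : 0 < l ->
  (fun n => s n / (n%:R * f n)) @ \oo --> (1 : R) ->
  (fun n => (n * p n)%:R * f n) @ \oo --> l ->
  (fun n => (p n)%:R * s n) @ \oo --> l.
Proof.
move=> l0 c1 c2; rewrite -[X in _ --> X]mul1r.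
apply: cvg_near_eq (cvgM c1 c2); near=> n.
have h : 0 < (n * p n)%:R * f n by near: n; exact: cvgr_gt c2 _ l0.
have nz : n%:R * f n != 0.
  apply: contraTneq h => h; rewrite natrM mulrAC h mul0r ltxx //.
rewrite /= (_ : (n * p n)%:R * f n = (n%:R * f n) * (p n)%:R).
  by rewrite mulrA divfK// mulrC.
by rewrite natrM mulrAC.
Unshelve. all: by end_near. Qed.

Lemma nrows_ge (kappa : R) n : 1 <= kappa -> (n <= nrows kappa n)%N.
Proof.
move=> k1; rewrite /nrows truncn_ge_nat ?powR_ge0//.
case: n => [|n]; first exact: powR_ge0.
rewrite -[leLHS]powRr1 ?ler0n//; apply: ler_powR => //.
by rewrite ler1n.
Qed.

End SequenceTransfer.

Section ScaleOfTail.
Context {R : realType} {d : measure_display} {T : measurableType d}.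
Variables (P : probability T R) (X : {RV P >-> R}) (a : nat -> R) (alpha : R).

Hypothesis tail : forall x : R, 0 < x ->
  (fun n : nat => n%:R * fine (P [set w | a n * x < `|X w|])) @ \oo --> x `^ (- alpha).

Lemma measurable_abs_tail u : measurable [set w | u < `|X w|].
Proof.
by apply: measurable_set_lt => //; apply: measurableT_comp => //; exact: measurable_funP.
Qed.

(** The normalizing sequence is arbitrary, but where [a n <= 0] the tail at [a n]
    is at least the tail at [0], and [n] times it would be unbounded. *)
Lemma normalizing_seq_gt0 : \forall n \near \oo, 0 < a n.
Proof.
pose F u := fine (P [set w | u < `|X w|]).
have Fmono u v : u <= v -> F v <= F u.
  move=> uv; apply: fine_prob_le; [exact: measurable_abs_tail.. | move=> w /=].
  exact: le_lt_trans.
have c1 : (fun n : nat => n%:R * F (a n)) @ \oo --> (1 : R).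
  have := tail ltr01; rewrite powR1.
  by under eq_fun do rewrite mulr1.
have hi : \forall n \near \oo, n%:R * F (a n) < 2 by apply: cvgr_lt c1 _ _; lra.
have lo : \forall n \near \oo, 0 < n%:R * F (a n) by apply: cvgr_gt c1 _ _; lra.
have F0 : 0 < F 0.
  rewrite ltNge; apply/negP => F0.
  near \oo => n.
  have n2 : (2 : R) < n%:R by near: n; exact: nbhs_infty_gtr.
  have h1 : n%:R * F (a n) < 2 by near: n.
  have h2 : 0 < n%:R * F (a n) by near: n.
  have [an0|an0] := leP 0 (a n).
    have := le_trans (Fmono _ _ an0) F0 => h3.
    by move: h2; rewrite ltNge mulr_ge0_le0.
  have F1 : F (a n) = 1.
    rewrite /F (_ : [set w | _] = setT) ?probability_setT//.
    by apply/seteqP; split=> w //= _; exact: lt_le_trans (normr_ge0 _).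
  by move: h1; rewrite F1 mulr1 ltNge ltW.
near=> n; rewrite ltNge; apply/negP => an0.
have n2 : 2 / F 0 < n%:R by near: n; exact: nbhs_infty_gtr.
have h1 : n%:R * F (a n) < 2 by near: n.
move: n2; rewrite ltr_pdivrMr// => n2.
have := ler_wpM2l (ler0n R n) (Fmono _ _ an0); lra.
Unshelve. all: by end_near. Qed.

Lemma lt_mul_sqrt (u x y : R) : 0 < u -> 0 < x -> 0 <= y ->
  (u ^+ 2 * x < y ^+ 2) = (u * Num.sqrt x < y).
Proof.
move=> u0 x0 y0; rewrite -[in LHS](sqr_sqrtr (ltW x0)) -exprMn.
by rewrite ltr_pXn2r// nnegrE mulr_ge0// ltW// ?sqrtr_gt0.
Qed.

Lemma powR_sqrt (x : R) : 0 < x -> Num.sqrt x `^ (- alpha) = x `^ (- (alpha / 2)).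
Proof.
move=> x0; rewrite -powR12_sqrt ?ltW// -powRrM; congr (_ `^ _); lra.
Qed.

Lemma cvg_sq_tail z : 0 < z ->
  (fun n : nat => n%:R * sq_tail X (a n ^+ 2 * z)) @ \oo --> z `^ (- (alpha / 2)).
Proof.
move=> z0; rewrite -powR_sqrt//.
apply: cvg_near_eq (tail _); last by rewrite sqrtr_gt0.
have := normalizing_seq_gt0; apply: filterS => n an0.
congr (_ * fine (P _)); apply/seteqP; split=> w /=;
  by rewrite -[X w ^+ 2]real_normK ?num_real// lt_mul_sqrt.
Qed.

End ScaleOfTail.

Section Assembly.
Context {R : realType} {d : measure_display} {T : measurableType d}.
Variables (P : probability T R) (X : nat -> {RV P >-> R}).
Variables (alpha : R) (a : nat -> R) (p : nat -> nat).
Variables (dM : nat -> measure_display) (TM : forall n, measurableType (dM n)).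
Variables (PM : forall n, probability (TM n) R).
Variable XM : forall n, 'I_(p n) -> 'I_n -> {RV (PM n) >-> R}.

Let B n := a (n * p n)%N ^+ 2.
Let beta := alpha / 2.
Let row n (w : T) : n.-tuple R := [tuple X t.+1 w | t < n].
Let rowM n (i : 'I_(p n)) (w : TM n) : n.-tuple R := [tuple XM i t w | t < n].
Let M n (w : TM n) : 'M[R]_(p n, n) := \matrix_(i < p n, t < n) XM i t w.
Let lam n (w : TM n) := max_eigenvalue (M w *m (M w)^T).
Let mx n (w : TM n) := max_sqr_entry (M w).

Hypothesis p_ge : forall n, (n <= p n)%N.
Hypothesis alpha02 : 0 < alpha < 2.
Hypothesis same_marginals : forall t, same_law P P (X t) (X 0%N).
Hypothesis tail : forall x : R, 0 < x ->
  (fun n : nat => n%:R * fine (P [set w | a n * x < `|X 0%N w|])) @ \oo --> x `^ (- alpha).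
Hypothesis sum_abs_tail : forall x : R, 0 < x ->
  (fun n : nat => fine (P [set w | a (n * p n)%N * x < row_sum_abs (row n w)])
     / (n%:R * fine (P [set w | a (n * p n)%N * x < `|X 0%N w|]))) @ \oo --> (1 : R).
Hypothesis sum_sqr_tail : forall x : R, 0 < x ->
  (fun n : nat => fine (P [set w | B n * x < row_sum_sqr (row n w)])
     / (n%:R * fine (P [set w | B n * x < X 0%N w ^+ 2]))) @ \oo --> (1 : R).
Hypothesis independent_rows : forall n, mutually_independent (PM n) (@rowM n).
Hypothesis row_law : forall n i, same_law (PM n) P (@rowM n i) (row n).

Let alpha0 : 0 < alpha. Proof. by case/andP: alpha02. Qed.
Let beta0 : 0 < beta. Proof. by rewrite /beta; have := alpha0; lra. Qed.
Let beta1 : beta < 1. Proof. by rewrite /beta; case/andP: alpha02 => _; lra. Qed.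

Let size_infty : (fun n => (n * p n)%N) @ \oo --> \oo.
Proof.
move=> A [N _ hN]; exists N.+1 => // n /= Nn; apply: hN => /=.
apply: leq_trans (leq_pmulr _ _); first exact: ltnW.
by apply: leq_trans (p_ge n); exact: leq_ltn_trans Nn.
Qed.

Let a_gt0 : \forall n \near \oo, 0 < a (n * p n)%N.
Proof. exact: (size_infty (normalizing_seq_gt0 tail)). Qed.

Let B_gt0 : \forall n \near \oo, 0 < B n.
Proof. by have := a_gt0; apply: filterS => n an; rewrite exprn_gt0. Qed.

Let cvg_abs_tail x : 0 < x ->
  (fun n => (n * p n)%:R * fine (P [set w | a (n * p n)%N * x < `|X 0%N w|]))
    @ \oo --> x `^ (- alpha).
Proof. by move=> x0; exact: (cvg_comp _ _ size_infty (tail x0)). Qed.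

Let cvg_G z : 0 < z ->
  (fun n => (n * p n)%:R * sq_tail (X 0%N) (B n * z)) @ \oo --> z `^ (- beta).
Proof. by move=> z0; exact: (cvg_comp _ _ size_infty (cvg_sq_tail tail z0)). Qed.

Let cvgU z : 0 < z ->
  (fun n => (p n)%:R * fine (P [set w | B n * z < row_sum_abs (row n w) ^+ 2]))
    @ \oo --> z `^ (- beta).
Proof.
move=> z0; have sz0 : 0 < Num.sqrt z by rewrite sqrtr_gt0.
rewrite -powR_sqrt//.
apply: cvg_near_eq (cvg_ratio_mul _ (sum_abs_tail sz0) (cvg_abs_tail sz0)).
  have := a_gt0; apply: filterS => n an.
  congr (_ * fine (P _)); apply/seteqP; split=> w /=;
    by rewrite lt_mul_sqrt// row_sum_abs_ge0.
exact: powR_gt0.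
Qed.

Let cvgV z : 0 < z ->
  (fun n => (p n)%:R * fine (P [set w | B n * z < row_sum_sqr (row n w)]))
    @ \oo --> z `^ (- beta).
Proof.
move=> z0; exact: cvg_ratio_mul (powR_gt0 _ z0) (sum_sqr_tail z0) (cvg_G z0).
Qed.

Let mrow n : measurable_fun setT (row n).
Proof. exact: (measurable_row (fun t : 'I_n => X t.+1)). Qed.

Let mU n : measurable_fun setT (fun w => row_sum_abs (row n w) ^+ 2).
Proof.
exact: (measurable_funX 2 (measurableT_comp (@measurable_row_sum_abs R n) (@mrow n))).
Qed.

Let mV n : measurable_fun setT (fun w => row_sum_sqr (row n w)).
Proof. exact: (measurableT_comp (@measurable_row_sum_sqr R n) (@mrow n)). Qed.

Let mW n : measurable_fun setT (fun w => row_max_sqr (row n w)).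
Proof. exact: (measurableT_comp (@measurable_row_max_sqr R n) (@mrow n)). Qed.

Let gap_tail eps : 0 < eps ->
  (fun n => (p n)%:R * fine (P [set w |
     eps * B n <= row_sum_abs (row n w) ^+ 2 - row_sum_sqr (row n w)])) @ \oo --> (0 : R).
Proof.
move=> eps0; apply: (gap_negligible beta0 B_gt0 mU mV _ _ cvgU cvgV) => //.
- by move=> n w; exact: row_sum_sqr_ge0.
- by move=> n w; exact: row_sum_sqr_le_sqr_sum.
Qed.

Let max_tail z : 0 < z ->
  (fun n => (p n)%:R * fine (P [set w | B n * z < row_max_sqr (row n w)]))
    @ \oo --> z `^ (- beta).
Proof.
move=> z0; apply: (gap_cvg_tail beta0 B_gt0 mU mV _ _ cvgU cvgV mW _ _ z0).
- by move=> n w; exact: row_sum_sqr_ge0.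
- by move=> n w; exact: row_sum_sqr_le_sqr_sum.
- by move=> n w; exact: row_max_sqr_le_sum.
- by move=> n w; exact: row_sum_sqr_sub_max_le.
Qed.

Let p_gt0 : \forall n \near \oo, (0 < p n)%N.
Proof. by exists 1%N => // n /= n0; exact: leq_trans (p_ge n). Qed.

(** Each of the [p] independent rows stays below [B * x] with probability
    [1 - y] where [p * y] tends to [x `^ (- beta)]; the limit law is that of a
    power of such factors. *)
Lemma cvg_max_sqr_entry x : 0 < x ->
  (fun n => fine (PM n [set w | mx w <= B n * x])) @ \oo --> expR (- (x `^ (- beta))).
Proof.
move=> x0; pose y n := fine (P [set w | B n * x < row_max_sqr (row n w)]).
have y0 n : 0 <= y n by exact: fine_prob_ge0.
have cy : y @ \oo --> 0.
  have -> : (0 : R) = x `^ (- beta) * 0 by rewrite mulr0.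
  have cp : (fun n => (p n)%:R^-1 : R) @ \oo --> (0 : R).
    apply: cvg0_le => [n|e e0]; first by rewrite invr_ge0.
    have : \forall n \near \oo, n%:R^-1 <= e by apply: cvgr_le (@cvg_natV R) _ e0.
    move=> [N _ hN]; exists N.+1 => // n /= Nn.
    apply: le_trans (hN n (ltnW Nn)).
    have n0 : (0 < n)%N by exact: leq_ltn_trans Nn.
    by rewrite lef_pV2 ?posrE ?ltr0n ?ler_nat//; exact: leq_trans (p_ge n).
  apply: cvg_near_eq (cvgM (max_tail x0) cp).
  have := p_gt0; apply: filterS => n pn; rewrite /= mulrAC divff ?mul1r//.
  by rewrite pnatr_eq0 -lt0n.
apply: cvg_near_eq (cvg_expn_onem y0 cy (max_tail x0)).
have := B_gt0; apply: filterS => n Bn.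
apply: prob_max_sqr_entry_le => //; first exact: row_law.
by rewrite mulr_ge0// ltW.
Qed.

Let measurable_lam n : (0 < p n)%N -> measurable_fun setT (@lam n).
Proof. by move=> pn; apply: measurable_max_eigenvalue => // i t; exact: measurable_M. Qed.

Let measurable_mx n : measurable_fun setT (@mx n).
Proof. by apply: measurable_max_sqr_entry => // i t; exact: measurable_M. Qed.

(** Division is handled by cases: the quotient is [0] where [mx] vanishes. *)
Let measurable_ratio_event n (eps : R) : (0 < p n)%N ->
  measurable [set w : TM n | eps < `|lam w / mx w - 1|].
Proof.
move=> pn; have mxm := @measurable_mx n; have lamm := @measurable_lam n pn.
rewrite (_ : [set w | _] = ([set w | mx w <= 0] `&` [set w | eps < 1]) `|`
    ([set w | 0 < mx w] `&` [set w | eps * mx w < `|lam w - mx w|])).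
  apply: measurableU; apply: measurableI; first exact: measurable_set_le.
  - by case: (eps < 1); [rewrite (_ : [set w | _] = setT) | rewrite (_ : [set w | _] = set0)];
      rewrite //; apply/seteqP; split.
  - exact: measurable_set_lt.
  - apply: measurable_set_lt; first exact: measurable_funM.
    by apply: measurableT_comp => //; exact: measurable_funB.
apply/seteqP; split=> w /=; have mx_ge0 := max_sqr_entry_ge0 (M w).
  have [mx0|mx0] := leP (mx w) 0.
    have -> : mx w = 0 by apply/eqP; rewrite eq_le mx0.
    by rewrite invr0 mulr0 sub0r normrN normr1; left.
  move=> h; right; split=> //; move: h.
  rewrite -{1}(divff (lt0r_neq0 mx0)) -mulrBl normrM [`|(mx w)^-1|]gtr0_norm ?invr_gt0//.
  by rewrite ltr_pdivlMr.
move=> [[mx0 h]|[mx0 h]].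
  have -> : mx w = 0 by apply/eqP; rewrite eq_le mx0.
  by rewrite invr0 mulr0 sub0r normrN normr1.
rewrite -{1}(divff (lt0r_neq0 mx0)) -mulrBl normrM [`|(mx w)^-1|]gtr0_norm ?invr_gt0//.
by rewrite ltr_pdivlMr.
Qed.

(** By Markov's inequality the probability is eventually at most
    [C * eps `^ (1 - beta) / eta], and [eps] is chosen to make this [e]. *)
Let small_part_le (e eta : R) : 0 < e -> 0 < eta ->
  exists2 eps, 0 < eps & \forall n \near \oo,
    fine (PM n (large_small_part (@XM n) (eps * B n) (eta * B n))) <= e.
Proof.
move=> e0 eta0.
have [C C0 hC] := truncated_mean_scaled beta0
  (sq_tail_nonincreasing (X 0%N))
  (filterS (fun n (h : 0 < a n) => exprn_gt0 2 h) (normalizing_seq_gt0 tail))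
  (cvg_sq_tail tail) beta1 (truncated_sq_mean_le (X 0%N))
  (truncated_sq_mean_double (X 0%N)).
have t0 : 0 < e * eta / C by rewrite divr_gt0// mulr_gt0.
pose eps := (e * eta / C) `^ (1 - beta)^-1.
have b1 : 1 - beta != 0 by rewrite gt_eqF// subr_gt0.
have epsE : eps `^ (1 - beta) = e * eta / C := powR_root b1 t0.
have eps0 : 0 < eps := powR_gt0 _ t0.
exists eps => //.
have hC' := size_infty (hC _ eps0).
near=> n; have Bn : 0 < B n by near: n; exact: B_gt0.
have h1 : (n * p n)%:R * truncated_sq_mean (X 0%N) (eps * B n) <= e * eta * B n.
  have : (n * p n)%:R * truncated_sq_mean (X 0%N) (eps * B n) <=
      C * eps `^ (1 - beta) * B n by near: n; exact: hC'.
  by rewrite epsE [C * _]mulrC divfK// gt_eqF.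
have h2 := prob_large_small_part (fun t => same_marginals t.+1) (row_law (n := n))
  (ltW (mulr_gt0 eps0 Bn)) (ltW (mulr_gt0 eta0 Bn)).
rewrite -(ler_pM2l (mulr_gt0 eta0 Bn)); apply: le_trans h2 _.
by apply: le_trans h1 _; lra.
Unshelve. all: by end_near. Qed.

Let two_in_column (eps e : R) : 0 < eps -> 0 < e -> \forall n \near \oo,
  fine (PM n (two_large_in_column (@XM n) (eps * B n))) <= e.
Proof.
move=> eps0 e0.
have c : (fun n => ((n * p n)%:R * sq_tail (X 0%N) (B n * eps)) ^+ 2 * n%:R^-1) @ \oo --> (0 : R).
  rewrite -[X in _ --> X](mulr0 ((eps `^ (- beta)) ^+ 2)).
  apply: cvgM; last exact: (@cvg_natV R).
  by under eq_fun do rewrite expr2; rewrite expr2; apply: cvgM; exact: cvg_G.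
near=> n.
have n0 : (0 < n)%N by near: n; exact: nbhs_infty_gt.
have h := prob_two_large_in_column (fun t => same_marginals t.+1)
  (@independent_rows n) (row_law (n := n)) (eps * B n).
apply: le_trans h _.
have -> : (n * (p n * p n))%:R * sq_tail (X 0%N) (eps * B n) ^+ 2 =
  ((n * p n)%:R * sq_tail (X 0%N) (B n * eps)) ^+ 2 * n%:R^-1.
  rewrite [eps * _]mulrC !natrM; field.
  by rewrite pnatr_eq0 -lt0n.
by near: n; exact: cvgr_le c _ e0.
Unshelve. all: by end_near. Qed.

(** The constants are chosen in this order: a lower level [c] for the maximum,
    at scale [B]; the relative error [dl] and the level [eta] for the small part,
    so that both error terms together stay below [eps * mx]; the truncation [s]. *)
Lemma max_eigenvalue_ratio (eps : R) : 0 < eps ->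
  (fun n => fine (PM n [set w | eps < `|lam w / mx w - 1|])) @ \oo --> (0 : R).
Proof.
move=> eps0; apply: cvg0_le => [n|e e0]; first exact: fine_prob_ge0.
have e40 : 0 < e / 4 by lra.
have [c c0 hc] : exists2 c, 0 < c & expR (- (c `^ (- beta))) < e / 4.
  pose t := `|ln (e / 4)| + 1.
  have t0 : 0 < t by rewrite /t ltr_wpDl.
  exists (t `^ (- beta)^-1); first exact: powR_gt0.
  rewrite powR_root// ?oppr_eq0 ?gt_eqF// -[ltRHS]lnK ?posrE// ltr_expR.
  have := ler_norm (- ln (e / 4)); rewrite normrN /t; lra.
pose dl := eps / 2.
have dl0 : 0 < dl by rewrite /dl; lra.
have k0 : 0 < 1 + dl^-1 by rewrite ltr_pwDl// invr_ge0 ltW.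
(* the absolute error [(1 + dl^-1) * eta * B] is then [dl * (c * B)] *)
pose eta := c * dl / (1 + dl^-1).
have eta0 : 0 < eta by rewrite divr_gt0// mulr_gt0.
have etaE : (1 + dl^-1) * eta = c * dl by rewrite /eta mulrC divfK// gt_eqF.
have [s s0 hs] := small_part_le e40 eta0.
near=> n.
have Bn : 0 < B n by near: n; exact: B_gt0.
have pn : (0 < p n)%N by near: n; exact: p_gt0.
have h1 : fine (PM n [set w | mx w <= B n * c]) <= e / 4.
  by near: n; apply: cvgr_le (cvg_max_sqr_entry c0) _ hc.
have h2 : fine (PM n (two_large_in_row (@XM n) (s * B n))) <= e / 4.
  apply: le_trans (prob_two_large_in_row (row_law (n := n)) _) _.
  by near: n; apply: cvgr_le (gap_tail s0) _ e40.
have h3 : fine (PM n (two_large_in_column (@XM n) (s * B n))) <= e / 4.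
  by near: n; exact: two_in_column.
have h4 : fine (PM n (large_small_part (@XM n) (s * B n) (eta * B n))) <= e / 4.
  by near: n; exact: hs.
have m1 : measurable [set w : TM n | mx w <= B n * c].
  by apply: measurable_set_le => //; exact: measurable_mx.
have m2 := measurable_two_large_in_row (@XM n) (s * B n).
have m3 := measurable_two_large_in_column (@XM n) (s * B n).
have m4 := measurable_large_small_part (@XM n) (s * B n) (eta * B n).
have sub : [set w : TM n | eps < `|lam w / mx w - 1|] `<=`
    ([set w : TM n | mx w <= B n * c] `|` two_large_in_row (@XM n) (s * B n)) `|`
    (two_large_in_column (@XM n) (s * B n) `|`
     large_small_part (@XM n) (s * B n) (eta * B n)).
  move=> w /= hw; apply: contrapT => /not_orP[/not_orP[n1 n2] /not_orP[n3 n4]].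
  have mxw : B n * c < mx w by rewrite ltNge; apply/negP.
  have mx0 : 0 < mx w by apply: lt_trans mxw; rewrite mulr_gt0.
  have := max_eigenvalue_le_outside pn (ltW (mulr_gt0 s0 Bn)) dl0 n2 n3 n4.
  rewrite -/(M w) -/(lam w) -/(mx w) mulrA etaE => up.
  have low : mx w <= lam w by exact: max_sqr_entry_le_max_eigenvalue.
  move: hw; rewrite ltNge => /negP; apply.
  have ge1 : 0 <= lam w / mx w - 1 by rewrite subr_ge0 ler_pdivlMr// mul1r.
  rewrite ger0_norm// lerBlDr ler_pdivrMr//.
  apply: le_trans up _.
  have : c * dl * B n <= dl * mx w.
    by rewrite mulrAC mulrC ler_pM2l// mulrC ltW.
  rewrite /dl; lra.
have m12 := measurableU _ _ m1 m2; have m34 := measurableU _ _ m3 m4.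
apply: le_trans (fine_prob_le (PM n) (measurable_ratio_event eps pn) (measurableU _ _ m12 m34) sub) _.
apply: le_trans (fine_probU_le _ m12 m34) _.
have := fine_probU_le (PM n) m1 m2; have := fine_probU_le (PM n) m3 m4; lra.
Unshelve. all: by end_near. Qed.

(** [mx <= lam] gives the upper bound.  For the lower one, [mx <= B * y] with
    [y < x] forces [lam <= B * x] unless the ratio exceeds [x / y]. *)
Lemma cvg_max_eigenvalue x : 0 < x ->
  (fun n => fine (PM n [set w | lam w <= B n * x])) @ \oo --> expR (- (x `^ (- beta))).
Proof.
move=> x0; set l := expR _.
have mlam n y : (0 < p n)%N -> measurable [set w : TM n | lam w <= B n * y].
  by move=> pn; apply: measurable_set_le => //; exact: measurable_lam.
have mmx n y : measurable [set w : TM n | mx w <= B n * y].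
  by apply: measurable_set_le => //; exact: measurable_mx.
apply: cvg_of_eventual_bounds => e e0.
  near=> n; have pn : (0 < p n)%N by near: n; exact: p_gt0.
  apply: (@le_trans _ _ (fine (PM n [set w | mx w <= B n * x]))).
    apply: fine_prob_le => //; first exact: mlam.
    by move=> w /=; apply: le_trans; exact: max_sqr_entry_le_max_eigenvalue.
  by near: n; apply: cvgr_le (cvg_max_sqr_entry x0) _ _; rewrite ltrDl.
have [y [y1 y2 hy]] : exists y, [/\ 3 / 4 * x <= y, y < x &
    l - e / 2 < expR (- (y `^ (- beta)))].
  have cl : expR (- (y `^ (- beta))) @[y --> x] --> l.
    apply: continuous_cvg; first exact: continuous_expR.
    by apply: cvgN; exact: cvg_powR.
  have ltl : l - e / 2 < l by lra.
  have : \forall y \near x, l - e / 2 < expR (- (y `^ (- beta))).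
    exact: cvgr_gt cl _ ltl.
  move=> /nbhs_ballP[r /= r0 hr].
  pose y := Num.max (3 / 4 * x) (x - r / 2).
  have y1 : 3 / 4 * x <= y /\ x - r / 2 <= y by rewrite !le_max !lexx orbT.
  have y2 : y < x by rewrite gt_max; apply/andP; split; lra.
  exists y; split => //; first by case: y1.
  by apply: hr; rewrite /ball/= ltr_norml; apply/andP; split; lra.
have y0 : 0 < y by lra.
pose eps := x / y - 1.
have eps0 : 0 < eps by rewrite subr_gt0 ltr_pdivlMr// mul1r.
have eps1 : eps < 1 by rewrite ltrBlDr ltr_pdivrMr//; lra.
near=> n.
have pn : (0 < p n)%N by near: n; exact: p_gt0.
have Bn : 0 < B n by near: n; exact: B_gt0.
have h1 : l - e / 2 <= fine (PM n [set w | mx w <= B n * y]).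
  by near: n; apply: cvgr_ge (cvg_max_sqr_entry y0) _ hy.
have h2 : fine (PM n [set w | eps < `|lam w / mx w - 1|]) <= e / 2.
  by near: n; apply: cvgr_le (max_eigenvalue_ratio eps0) _ _; lra.
have mr := measurable_ratio_event eps pn.
have sub : [set w : TM n | mx w <= B n * y] `<=`
   [set w | lam w <= B n * x] `|` [set w | eps < `|lam w / mx w - 1|].
  move=> w /= hw; have [hr|hr] := ltP eps `|lam w / mx w - 1|; [by right | left].
  have mx0 : 0 < mx w.
    rewrite lt_neqAle max_sqr_entry_ge0 andbT; apply/eqP => mx0.
    by move: hr; rewrite -mx0 invr0 mulr0 sub0r normrN normr1 leNgt eps1.
  have : lam w / mx w <= x / y.
    by have := le_trans (ler_norm _) hr; rewrite /eps; lra.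
  rewrite ler_pdivrMr// => /le_trans; apply.
  rewrite mulrAC ler_pdivrMr// mulrC [leRHS]mulrAC.
  by rewrite ler_pM2r.
have := fine_prob_le (PM n) (mmx n y) (measurableU _ _ (mlam n x pn) mr) sub.
have := fine_probU_le (PM n) (mlam n x pn) mr; lra.
Unshelve. all: by end_near. Qed.

End Assembly.

(** * The largest eigenvalue of a heavy-tailed random matrix *)

Lemma stationary_marginals {R : realType} {d} {T : measurableType d}
    (P : probability T R) (X : nat -> {RV P >-> R}) :
  strictly_stationary P (fun t w => X t w) ->
  forall t, same_law P P (X t) (X 0%N).
Proof.
move=> stat t A mA.
have mA' := measurable_tnth_preimage (n := 1) ord0 mA.
have := stat t 1%N (fun=> 0%N) _ mA'.
rewrite (_ : _ @^-1` _ = X 0%N @^-1` A); last first.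
  by apply/seteqP; split=> w; rewrite /= tnth_mktuple.
move=> ->; congr (P _).
by apply/seteqP; split=> w; rewrite /= tnth_mktuple add0n.
Qed.

Theorem theorem5p1 (R : realType)
  (d : measure_display) (T : measurableType d) (P : probability T R)
  (X : nat -> {RV P >-> R})
  (alpha : R) (a : nat -> R) (kappa : R)
  (dM : nat -> measure_display) (TM : forall n, measurableType (dM n))
  (PM : forall n, probability (TM n) R)
  (XM : forall n, 'I_(nrows kappa n) -> 'I_n -> {RV (PM n) >-> R}) :
  let p := nrows kappa in
  let M := fun n (w : TM n) =>
    (\matrix_(i < p n, t < n) XM n i t w : 'M[R]_(p n, n)) in
  let rowM := fun n (i : 'I_(p n)) (w : TM n) =>
    [tuple XM n i t w | t < n] in
  strictly_stationary P (fun t w => X t w) ->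
  0 < alpha < 2 ->
  (forall x : R, 0 < x ->
    (fun n : nat => n%:R * fine (P [set w | a n * x < `|X 0%N w|]))
      @ \oo --> x `^ (- alpha)) ->
  has_extremal_index P (fun t w => `|X t w|) 1 ->
  1 <= kappa ->
  (forall x : R, 0 < x ->
    (fun n : nat =>
       fine (P [set w | a (n * p n)%N * x < \sum_(1 <= t < n.+1) `|X t w|])
       / (n%:R * fine (P [set w | a (n * p n)%N * x < `|X 0%N w|])))
      @ \oo --> (1 : R)) ->
  (forall x : R, 0 < x ->
    (fun n : nat =>
       fine (P [set w |
         a (n * p n)%N ^+ 2 * x < \sum_(1 <= t < n.+1) X t w ^+ 2])
       / (n%:R * fine (P [set w | a (n * p n)%N ^+ 2 * x < X 0%N w ^+ 2])))
      @ \oo --> (1 : R)) ->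
  (forall n, mutually_independent (PM n) (@rowM n)) ->
  (forall n (i : 'I_(p n)),
    same_law (PM n) P (rowM n i) (fun w => [tuple X t.+1 w | t < n])) ->
  cvg_in_probability PM
    (fun n w => max_eigenvalue (M n w *m (M n w)^T) / max_sqr_entry (M n w)) 1
  /\
  (forall x : R, 0 < x ->
    (fun n : nat => fine (PM n [set w |
       max_eigenvalue (M n w *m (M n w)^T) <= a (n * p n)%N ^+ 2 * x]))
      @ \oo --> expR (- (x `^ (- (alpha / 2))))).
Proof.
move=> p M rowM stat alpha02 tail _ kappa1 sum_abs sum_sqr indep law.
have same := stationary_marginals stat.
have p_ge n : (n <= p n)%N by exact: nrows_ge.
have sumE (f : R -> R) n w : \sum_(t < n) f (tnth [tuple X t.+1 w | t < n] t) =
    \sum_(1 <= t < n.+1) f (X t w).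
  by rewrite big_add1 big_mkord; apply: eq_bigr => t _; rewrite tnth_mktuple.
have sumA n w : row_sum_abs [tuple X t.+1 w | t < n] = \sum_(1 <= t < n.+1) `|X t w|.
  exact: (sumE Num.norm).
have sumS n w : row_sum_sqr [tuple X t.+1 w | t < n] = \sum_(1 <= t < n.+1) X t w ^+ 2.
  exact: (sumE (fun y => y ^+ 2)).
have sum_abs' x : 0 < x ->
    (fun n : nat => fine (P [set w | a (n * p n)%N * x <
        row_sum_abs [tuple X t.+1 w | t < n]])
     / (n%:R * fine (P [set w | a (n * p n)%N * x < `|X 0%N w|]))) @ \oo --> (1 : R).
  move=> x0; apply: cvg_near_eq (sum_abs x x0); apply: nearW => n.
  by under eq_set do rewrite sumA.
have sum_sqr' x : 0 < x ->
    (fun n : nat => fine (P [set w | a (n * p n)%N ^+ 2 * x <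
        row_sum_sqr [tuple X t.+1 w | t < n]])
     / (n%:R * fine (P [set w | a (n * p n)%N ^+ 2 * x < X 0%N w ^+ 2]))) @ \oo --> (1 : R).
  move=> x0; apply: cvg_near_eq (sum_sqr x x0); apply: nearW => n.
  by under eq_set do rewrite sumS.
split=> [eps eps0|x x0].
  exact: (max_eigenvalue_ratio p_ge alpha02 same tail sum_abs' sum_sqr' indep law eps0).
exact: (cvg_max_eigenvalue p_ge alpha02 same tail sum_abs' sum_sqr' indep law x0).
Qed.
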